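(* Let $\mathcal C: Q=0$ be a non-singular genus three plane curve defined over a field $K$ with $\operatorname{char}(K)\neq 2$. Let $\{X_1=0,Y_1=0\}$, $\{X_2=0,Y_2=0\}$, $\{X_3=0,Y_3=0\}$ be three (different) pairs of bitangent lines from a given Steiner complex. Let $\{X_7=0,Y_7=0\}$ be a pair of bitangent lines from the Steiner complex determined by the pairs $\{X_1=0,Y_2=0\}$ and $\{X_2=0,Y_1=0\}$ (a further pair, different from these two), ordered so that the triplets $\{X_1=0,X_3=0,X_7=0\}$ and $\{X_1=0,Y_3=0,Y_7=0\}$ are asyzygetic. Then the equation of $\mathcal C$ can be presented as $$ \begin{array}{c} \displaystyle Q\sim\left(\frac{(X_7X_2X_3)(X_7Y_2Y_3)}{(X_1X_2X_3)(Y_1Y_2Y_3)}X_1Y_1+\frac{(X_1X_7X_3)(Y_1X_7Y_3)}{(X_1X_2X_3)(Y_1Y_2Y_3)}X_2Y_2-\frac{(X_1X_2X_7)(Y_1Y_2X_7)}{(X_1X_2X_3)(Y_1Y_2Y_3)}X_3Y_3\right)^2\\[4mm] \displaystyle-4\,\frac{(X_7X_2X_3)(X_7Y_2Y_3)}{(X_1X_2X_3)(Y_1Y_2Y_3)}\cdot\frac{(X_1X_7X_3)(Y_1X_7Y_3)}{(X_1X_2X_3)(Y_1Y_2Y_3)}\,X_1Y_1X_2Y_2=0, \end{array} $$ where $(ABC)$ denotes the determinant of the $3\times 3$ matrix formed by the coefficients of the homogeneous linear polynomials $A,B,C$.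
   Context: $\mathcal C$ is embedded in the projective plane by its canonical map, so $Q$ is a quartic form. $Q_1\sim Q_2$ means that the polynomials $Q_1,Q_2$ agree up to a (nonzero) constant factor. The curve has 28 bitangent lines (over an algebraic closure $\overline K$); each is given as $X=0$ with $X$ a linear form over $\overline K$, and satisfies $\operatorname{div}(X)=2P+2R$ on $\mathcal C$ with contact points $P,R$ (possibly equal). A triplet or tetrad of distinct bitangent lines is syzygetic if their contact points (with multiplicity) lie on a conic; otherwise it is asyzygetic. Any pair of bitangent lines can be completed in exactly five ways with another pair to a syzygetic tetrad; any two of the resulting six pairs form a syzygetic tetrad. Such a set of six pairs is a Steiner complex; it is determined by any one of its pairs. *)

(* Defs.v *)
From HB Require Import structures.
From mathcomp Require Import all_boot all_order all_algebra.
From mathcomp.multinomials Require Export mpoly.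
Set Implicit Arguments.
Unset Strict Implicit.
Unset Printing Implicit Defensive.
Import GRing.Theory.
Local Open Scope ring_scope.

(* Points of the projective plane over L are nonzero row vectors up to scaling;
   two of them are the same point iff they span the same row space.
   The curve is the zero locus of a ternary form Q over L. *)

Section PlaneCurves.
Variable L : fieldType.
Implicit Types (F G Q X Y Z W A B : {mpoly L[3]}) (P R S : 'rV[L]_3).

Definition eval_at P F : L := F.@[P 0].

Definition same_point P R : bool := (P == R)%MS.

Definition on_curve Q P : Prop := P != 0 /\ eval_at P Q = 0.

Definition nonsingular Q : Prop :=
  forall P, on_curve Q P -> exists i : 'I_3, eval_at P (Q^`M(i)) != 0.

(* Used both for the relation "~" between polynomials and for the equality of
   the lines defined by two nonzero linear forms. *)
Definition proportional F G : Prop := exists2 c : L, c != 0 & F = c *: G.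

(* F lies in the m-th power of the maximal ideal of the vector P in affine
   3-space: its Taylor expansion at P has no term of degree less than m. *)
Definition vanishes_to_order P F (m : nat) : Prop :=
  forall k : 'X_{1..3}, (mdeg k < m)%N ->
    (F \mPo [tuple ('X_i + (P 0 i)%:MP) | i < 3])@_k = 0.

(* ord_P(F) >= m on the curve Q = 0, for a form F and a nonsingular point P:
   F lies in the m-th power of the maximal ideal of the local ring at P of the
   affine cone over the curve.  Near P the cone is the product of the curve and
   the radial direction, along which F only changes by a unit, so this is the
   order of F in the discrete valuation ring of the curve at P. *)
Definition ord_ge Q P F (m : nat) : Prop :=
  exists h a : {mpoly L[3]},
    eval_at P h != 0 /\ vanishes_to_order P (h * F - a * Q) m.

(* The coefficient of S in the divisor P + R. *)
Definition mult_in P R S : nat := same_point S P + same_point S R.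

(* X = 0 is a line with div(X) = 2P + 2R on the curve. *)
Definition bitangent_at Q X P R : Prop :=
  [/\ X \is 1.-homog, X != 0, on_curve Q P, on_curve Q R
    & forall S, on_curve Q S ->
        forall m : nat, ord_ge Q S X m <-> (m <= 2 * mult_in P R S)%N].

Definition bitangent Q X : Prop := exists P R, bitangent_at Q X P R.

Definition distinct_bitangents Q n (l : n.-tuple {mpoly L[3]}) : Prop :=
  (forall i, bitangent Q (tnth l i)) /\
  (forall i j, i != j -> ~ proportional (tnth l i) (tnth l j)).

(* Some conic G = 0 (possibly reducible) satisfies div(G) >= sum_i (P_i + R_i)
   on the curve, where P_i, R_i are the contact points of the i-th line. *)
Definition contacts_on_conic Q n (l : n.-tuple {mpoly L[3]}) : Prop :=
  exists P R : 'I_n -> 'rV[L]_3,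
    (forall i, bitangent_at Q (tnth l i) (P i) (R i)) /\
    (exists G, [/\ G \is 2.-homog, G != 0
       & forall S, on_curve Q S ->
           ord_ge Q S G (\sum_(i < n) mult_in (P i) (R i) S)%N]).

(* Only used for n = 3 and n = 4. *)
Definition syzygetic Q n (l : n.-tuple {mpoly L[3]}) : Prop :=
  distinct_bitangents Q l /\ contacts_on_conic Q l.

Definition asyzygetic Q n (l : n.-tuple {mpoly L[3]}) : Prop :=
  distinct_bitangents Q l /\ ~ contacts_on_conic Q l.

(* Equality of the unordered pairs of lines {X = 0, Y = 0}, {Z = 0, W = 0}. *)
Definition same_pair X Y Z W : Prop :=
  (proportional X Z /\ proportional Y W) \/
  (proportional X W /\ proportional Y Z).

(* The pair {Z = 0, W = 0} belongs to the Steiner complex determined by the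
   pair {A = 0, B = 0}: it is that pair, or completes it to a syzygetic
   tetrad. *)
Definition in_steiner_complex Q A B Z W : Prop :=
  same_pair Z W A B \/ syzygetic Q [tuple A; B; Z; W].

Definition bracket A B C : L :=
  \det (\matrix_(i < 3, j < 3) (tnth [tuple A; B; C] i)@_(U_(j)%MM)).

End PlaneCurves.

(* Main.v *)
Require Import Defs.
From HB Require Import structures.
From mathcomp Require Import all_boot all_order all_algebra.
From mathcomp Require Import ring.
Set Implicit Arguments.
Unset Strict Implicit.
Unset Printing Implicit Defensive.
Import GRing.Theory.
Local Open Scope ring_scope.

(** Write [riemann_form a b c] for (a + b - c)^2 - 4ab, the norm of
    sqrt a + sqrt b + sqrt c.  The proof brings the quartic to the shape
    Q = riemann_form (a1 X1Y1) (a2 X2Y2) (a3 X3Y3) and then reads the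
    coefficients off X7, so that only polynomial identities and the local
    geometry of bitangents are involved.

    Syzygetic tetrads become identities.  On a bitangent, Q restricts to the
    square of a binary quadratic form vanishing at the contact points, so a
    conic G through the contact points satisfies G^2 = kQ on that line
    ([contact_restriction]).  Two bitangents of a smooth quartic never meet on
    the curve, so comparing values at their intersection gives the same k for
    all four lines of a tetrad; hence Q = G^2 - c ABXY after rescaling
    ([syzygetic_identity]).  Conversely such an identity produces contact
    conics ([contacts_on_conic3]).

    Three pairs give a Riemann form.  If Q = G1^2 - c1 AB E1 = G2^2 - c2 AB E2,
    then AB divides (G1 - G2)(G1 + G2).  The lines A and B must divide the same
    factor, for otherwise Q would be singular where they meet; so, up to the
    sign of G2, G1 - G2 = s AB, and eliminating G2 expresses G1, hence Q,
    through AB, E1 and E2 ([three_pairs]).  Smoothness also makes any three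
    lines taken from the three pairs independent ([riemann_bracket_neq0]).

    The line X7.  The pairs (X1, Y2), (X2, Y1), (X7, Y7) give a second
    Riemann form of Q.  Its first two terms have the same product X1Y1X2Y2, up
    to constants, as those of the first form, and smoothness forces the two
    squared conics to agree up to sign ([opposite_pairs]).  This equality says
    that a linear form l in X1, X2 times a linear form m in Y1, Y2 equals
    a3 X3Y3 - b3 X7Y7, so l or m vanishes where X3 and X7 meet.
    If l does, then X7 = r1X1 + r2X2 + r3X3 = s1Y1 + s2Y2 + s3Y3 with
    (r1s1, r2s2, r3s3) proportional to (a1, a2, a3), and Cramer's rule turns
    r_i and s_i into quotients of brackets.  If m does, the same relations hold
    with the roles of X3 and Y3 exchanged, and they give
    Q = U^2 - X1X3X7W ([riemann_identity]), so that X1, X3, X7 would be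
    syzygetic ([seventh_line]). *)

(** * Polynomials over an infinite field as functions *)

Lemma mpoly_gen_ind n (R : comNzRingType) (P : {mpoly R[n]} -> Prop) :
  (forall c, P c%:MP) -> (forall i, P 'X_i) ->
  (forall F G, P F -> P G -> P (F + G)) ->
  (forall F G, P F -> P G -> P (F * G)) -> forall F, P F.
Proof.
move=> hC hX hD hM; elim/mpolyind => [|c m F _ _ hF]; first by rewrite -mpolyC0.
apply: (hD _ _ _ hF); rewrite -mul_mpolyC; apply: (hM _ _ (hC c)).
rewrite mpolyXE_id; apply: big_ind => [||i _] //; first by rewrite -mpolyC1.
by elim: (m i) => [|k hk]; rewrite ?expr0 -?mpolyC1 // exprS; apply: hM.
Qed.

Lemma rmorph_mpoly_ext n (R S : comNzRingType)
    (f g : {rmorphism {mpoly R[n]} -> S}) :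
  (forall c, f c%:MP = g c%:MP) -> (forall i, f 'X_i = g 'X_i) -> f =1 g.
Proof.
move=> hC hX; elim/mpoly_gen_ind => // F G hF hG.
  by rewrite !rmorphD hF hG.
by rewrite !rmorphM hF hG.
Qed.

Lemma muni_widen (n : nat) (R : comNzRingType) (j : 'I_n) :
  muni 'X_(widen_ord (leqnSn n) j) = ('X_j)%:P :> {poly {mpoly R[n]}}.
Proof.
rewrite /muni mmapX mmap1U; case: splitP => [k /= hk|k /= hk].
  by congr ('X_ _)%:P; apply: val_inj; rewrite /= -hk.
by have := ltn_ord j; rewrite [val j]hk ord1 addn0 ltnn.
Qed.

Lemma muni_max (n : nat) (R : comNzRingType) :
  muni 'X_ord_max = 'X :> {poly {mpoly R[n]}}.
Proof.
rewrite /muni mmapX mmap1U; case: splitP => [k /= hk|k /= hk //].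
by have := ltn_ord k; rewrite -hk ltnn.
Qed.

Lemma ord_widen_max n (P : 'I_n.+1 -> Prop) :
  (forall j, P (widen_ord (leqnSn n) j)) -> P ord_max -> forall i, P i.
Proof.
move=> hw hm i; case: (ltnP i n) => hi.
  by have := hw (Ordinal hi); congr P; apply: val_inj.
suff -> : i = ord_max by [].
by apply: val_inj; apply/eqP; rewrite /= eqn_leq hi -ltnS ltn_ord.
Qed.

Lemma muniK n (R : comNzRingType) (F : {mpoly R[n.+1]}) :
  (map_poly (@mwiden n R) (muni F)).['X_ord_max] = F.
Proof.
pose g : {rmorphism {poly {mpoly R[n]}} -> {mpoly R[n.+1]}} :=
  horner_eval 'X_ord_max \o map_poly (@mwiden n R).
pose f : {rmorphism {mpoly R[n.+1]} -> {mpoly R[n.+1]}} := g \o @muni n R.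
rewrite -[RHS]/(idfun F); apply: (rmorph_mpoly_ext (f := f) (g := idfun)).
  by move=> c; rewrite /= /horner_eval muniC map_polyC hornerC /= mwidenC.
apply: ord_widen_max => [j|] /=.
  rewrite muni_widen /horner_eval map_polyC hornerC /=.
  by rewrite /mwiden mmapX mmap1U.
by rewrite muni_max /horner_eval map_polyX hornerX.
Qed.

Lemma meval_muni n (R : comNzRingType) (F : {mpoly R[n.+1]}) (w : 'I_n -> R) v :
  (forall j, v (widen_ord (leqnSn n) j) = w j) ->
  (map_poly (meval w) (muni F)).[v ord_max] = F.@[v].
Proof.
move=> hv.
pose g : {rmorphism {poly {mpoly R[n]}} -> R} :=
  horner_eval (v ord_max) \o map_poly (meval w).
pose f : {rmorphism {mpoly R[n.+1]} -> R} := g \o @muni n R.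
apply: (rmorph_mpoly_ext (f := f) (g := meval v)).
  by move=> c; rewrite /= /horner_eval muniC map_polyC hornerC /= !mevalC.
apply: ord_widen_max => [j|] /=.
  by rewrite muni_widen /horner_eval map_polyC hornerC /= !mevalXU hv.
by rewrite muni_max /horner_eval map_polyX hornerX mevalXU.
Qed.

(** Induction on the number of variables: specialize all variables but the last
    where the leading coefficient in the last one does not vanish. *)
Lemma meval_neq0 (L : closedFieldType) n (F : {mpoly L[n]}) :
  F != 0 -> exists v, F.@[v] != 0.
Proof.
elim: n F => [|n IH] F hF.
  by exists (fun=> 0); move: hF; rewrite [F]nvar0_mpolyC mevalC mpolyC_eq0.
have hm : lead_coef (muni F) != 0.
  by rewrite lead_coef_eq0; apply: contraNneq hF => h;
    rewrite -[F]muniK h rmorph0 horner0.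
have [w hw] := IH _ hm.
have /closed_nonrootP[x] : map_poly (meval w) (muni F) != 0.
  apply: contraNneq hw => h.
  by rewrite -[X in X == 0]/(meval w _) -coef_map h coef0.
pose v (i : 'I_n.+1) := if insub (val i) : option 'I_n is Some j then w j else x.
rewrite -[x](_ : v ord_max = x); last by rewrite /v insubF //= ltnn.
rewrite /root meval_muni => [hv|j]; first by exists v.
by rewrite /v /= insubT //= => h; congr w; apply: val_inj.
Qed.

(** * Restriction of a form to a parametrized line *)
Section LineRestriction.
Variable L : closedFieldType.
Implicit Types (F G Q X Y A B : {mpoly L[3]}) (P T S : 'rV[L]_3).

(** A derivation at P is determined by its values on the variables.  This gives
    the chain rule for [restr] without computing with monomials. *)
Lemma derivation_at P (D : {additive {mpoly L[3]} -> L}) F :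
  (forall c, D c%:MP = 0) ->
  (forall F G, D (F * G) = D F * G.@[P 0] + F.@[P 0] * D G) ->
  D F = \sum_i D 'X_i * (F^`M(i)).@[P 0].
Proof.
move=> hC hM; elim/mpoly_gen_ind: F => [c|j|F G hF hG|F G hF hG].
- by rewrite hC big1 // => i _; rewrite mderivC meval0 mulr0.
- rewrite (bigD1 j) //= big1 => [|i hi].
    have -> : 'X_j^`M(j) = 1 :> {mpoly L[3]}.
      rewrite mderivX mnm1E eqxx scale1r -mpolyX0; congr 'X_[_].
      by apply/mnmP => k; rewrite mnmBE mnm0E subnn.
    by rewrite meval1 mulr1 addr0.
  by rewrite mderivX mnm1E eq_sym (negPf hi) scale0r meval0 mulr0.
- rewrite raddfD /= hF hG -big_split; apply: eq_bigr => i _ /=.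
  by rewrite mderivD mevalD mulrDr.
- rewrite hM hF hG mulr_suml mulr_sumr -big_split; apply: eq_bigr => i _ /=.
  by rewrite mderivM mevalD !mevalM; ring.
Qed.

(** F along the line through P in direction T, as a polynomial in z: F(P + zT). *)
Definition restr P T : {mpoly L[3]} -> {poly L} :=
  mmap polyC (fun i => (P 0 i)%:P + (T 0 i) *: 'X).

HB.instance Definition _ P T := GRing.RMorphism.copy (restr P T)
  (mmap polyC (fun i => (P 0 i)%:P + (T 0 i) *: 'X)).

Lemma restrC P T c : restr P T c%:MP = c%:P.
Proof. by rewrite /restr mmapC. Qed.

Lemma restrX P T i : restr P T 'X_i = (P 0 i)%:P + (T 0 i) *: 'X.
Proof. by rewrite /restr mmapX mmap1U. Qed.

Lemma restrZ P T c F : restr P T (c *: F) = c *: restr P T F.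
Proof. by rewrite -mul_mpolyC rmorphM /= restrC mul_polyC. Qed.

Lemma horner_restr P T F z : (restr P T F).[z] = F.@[(P + z *: T) 0].
Proof.
pose f : {rmorphism {mpoly L[3]} -> L} := horner_eval z \o restr P T.
apply: (rmorph_mpoly_ext (f := f) (g := meval ((P + z *: T) 0))) => [c|i] /=.
  by rewrite restrC mevalC /horner_eval hornerC.
by rewrite restrX mevalXU /horner_eval !hornerE !mxE; ring.
Qed.

Lemma coef0_restr P T F : (restr P T F)`_0 = F.@[P 0].
Proof. by rewrite -horner_coef0 horner_restr scale0r addr0. Qed.

Lemma coef1_restr P T F :
  (restr P T F)`_1 = \sum_i T 0 i * (F^`M(i)).@[P 0].
Proof.
pose D : {additive {mpoly L[3]} -> L} := coefp 1 \o restr P T.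
rewrite -[LHS]/(D F) (@derivation_at P D).
- by apply: eq_bigr => i _ /=; rewrite restrX coefD coefC coefZ coefX /= add0r mulr1.
- by move=> c; rewrite /= restrC coefC.
move=> F1 F2; rewrite /= rmorphM coefM !big_ord_recl big_ord0 /= !coef0_restr.
by rewrite /bump /= addr0 addrC -!(coef0_restr P T).
Qed.

Lemma restr_shift P T z F :
  restr (P + z *: T) T F = restr P T F \Po ('X + z%:P).
Proof.
pose f : {rmorphism {mpoly L[3]} ->
  {poly L}} := comp_poly ('X + z%:P) \o restr P T.
rewrite -[RHS]/(f F); apply: rmorph_mpoly_ext => [c|i] /=.
  by rewrite !restrC comp_polyC.
rewrite !restrX rmorphD /= comp_polyC linearZ /= comp_polyX !mxE.
by rewrite scalerDr polyCD polyCM -!mul_polyC; ring.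
Qed.

(** The coefficient of z^d is the value at the point at infinity T of the line,
    so it is this coefficient that records a zero at T. *)
Lemma restr_homog P T F d : F \is d.-homog ->
  (size (restr P T F) <= d.+1)%N /\ (restr P T F)`_d = F.@[T 0].
Proof.
have top1 (i : 'I_3) : (size ((P 0 i)%:P + T 0 i *: 'X)%R <= 2)%N /\
  ((P 0 i)%:P + T 0 i *: 'X)`_1 = T 0 i.
  split; last by rewrite coefD coefC coefZ coefX /= add0r mulr1.
  apply: (leq_trans (size_polyD _ _));
    rewrite geq_max (leq_trans (size_polyC_leq1 _)) //.
  by rewrite (leq_trans (size_scale_leq _ _)) // size_polyX.
have topM (p q : {poly L}) a b : (size p <= a.+1)%N -> (size q <= b.+1)%N ->
  (size (p * q)%R <= (a + b).+1)%N /\ (p * q)`_(a + b) = p`_a * q`_b.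
  move=> hp hq; split.
    by rewrite (leq_trans (size_polyMleq _ _)) // -subn1 leq_subLR add1n -addnS -addSn leq_add.
  have ha : (a < (a + b).+1)%N by rewrite ltnS leq_addr.
  rewrite coefM (bigD1 (Ordinal ha)) //= addKn big1 ?addr0 // => j /negPf hj.
  have {}hj : (j == a :> nat) = false by rewrite -hj.
  case: (ltngtP j a) hj => // hj _; last first.
    by rewrite nth_default ?mul0r // (leq_trans hp).
  by rewrite [q`_ _]nth_default ?mulr0 // (leq_trans hq) // ltn_subRL ltn_add2r.
have topX (p : {poly L}) a : (size p <= 2)%N ->
  (size (p ^+ a) <= a.+1)%N /\ (p ^+ a)`_a = p`_1 ^+ a.
  move=> hp; elim: a => [|a [ha ea]]; first by rewrite !expr0 size_poly1 coef1.
  by rewrite exprS -add1n; have [-> ->] := topM _ _ _ _ hp ha; rewrite ea exprS.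
move=> /dhomogP hF; rewrite [F in restr P T F]mpolyE rmorph_sum /= mevalE.
rewrite big_seq [in X in _ /\ _ = X]big_seq.
elim/big_rec2: _ => [|m c p mF [hp <-]]; first by rewrite size_poly0 coef0.
rewrite restrZ mpolyXE_id rmorph_prod.
have [hs hc] : (size (\prod_i restr P T ('X_i ^+ m i))%R <= (\sum_i m i).+1)%N /\
    (\prod_i restr P T ('X_i ^+ m i))`_(\sum_i m i) = \prod_i T 0 i ^+ m i.
  elim/big_rec3: _ => [|i u s q _ [hq eq]]; first by rewrite size_poly1 coef1.
  have [h1 h2] := top1 i.
  have [h3 h4] := topX _ (m i) h1.
  rewrite rmorphXn /= restrX.
  by have [-> ->] := topM _ _ _ _ h3 hq; rewrite h4 h2 eq.
rewrite -mdegE hF // in hs hc.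
split; last by rewrite coefD coefZ hc.
apply: (leq_trans (size_polyD _ _)); rewrite geq_max hp andbT.
exact: leq_trans (size_scale_leq _ _) hs.
Qed.

(** Moves the Taylor expansion at P used by [vanishes_to_order] to the origin. *)
Lemma restr_taylor P T F :
  restr P T F = restr 0 T (F \mPo [tuple ('X_i + (P 0 i)%:MP) | i < 3]).
Proof.
pose sh := comp_mpoly [tuple ('X_i + (P 0 i)%:MP : {mpoly L[3]}) | i < 3].
pose g : {rmorphism {mpoly L[3]} -> {poly L}} := restr 0 T \o sh.
rewrite -[RHS]/(g F); apply: rmorph_mpoly_ext => [c|i] /=.
  by rewrite /sh comp_mpolyC !restrC.
rewrite /sh comp_mpolyXU -tnth_nth tnth_mktuple rmorphD /= restrC !restrX mxE.
by rewrite addrC add0r.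
Qed.

Lemma restr_vanishes P T F m :
  vanishes_to_order P F m -> 'X^m %| restr P T F.
Proof.
rewrite restr_taylor => hF; set G := _ \mPo _ in hF *.
rewrite [G]mpolyE rmorph_sum /=; apply: (big_ind (fun p => 'X^m %| p)).
- exact: dvdp0.
- by move=> p q; apply: dvdp_add.
move=> k _; case: (ltnP (mdeg k) m) => hk;
  first by rewrite hF // scale0r rmorph0 dvdp0.
rewrite restrZ -mul_polyC dvdp_mull // mpolyXE_id rmorph_prod; move: hk;
  rewrite mdegE => hk.
apply: (dvdp_trans (dvdp_exp2l _ hk)).
elim/big_rec2: _ => [|i d q _ hq]; first by rewrite expr0 dvdpp.
rewrite exprD dvdp_mul // rmorphXn /= restrX mxE add0r dvdp_exp2r //.
by rewrite -mul_polyC dvdp_mull.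
Qed.

Lemma coef0_taylor P F :
  (F \mPo [tuple ('X_i + (P 0 i)%:MP) | i < 3])@_0%MM = F.@[P 0].
Proof.
rewrite -(coef0_restr P 0) restr_taylor coef0_restr; set G := _ \mPo _.
pose g : {rmorphism {mpoly L[3]} -> L} := mcoeff 0%MM.
rewrite -[LHS]/(g G); apply: rmorph_mpoly_ext => [c|i] /=.
  by rewrite mcoeffC eqxx mulr1 mevalC.
by rewrite mcoeffX mnm1_eq0 mevalXU mxE.
Qed.

Lemma coef1_taylor P F (i : 'I_3) :
  (F \mPo [tuple ('X_i + (P 0 i)%:MP) | i < 3])@_(U_(i)%MM) = (F^`M(i)).@[P 0].
Proof.
have coef1e S H : (restr S (delta_mx 0 i) H)`_1 = (H^`M(i)).@[S 0].
  rewrite coef1_restr (bigD1 i) //= big1 => [|j hj].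
    by rewrite mxE !eqxx mul1r addr0.
  by rewrite mxE eqxx /= (negPf hj) mul0r.
rewrite -coef1e restr_taylor coef1e; set G := _ \mPo _.
have := coef0_taylor 0 (G^`M(i)); set H := _ \mPo _ => <-.
have -> : H = G^`M(i).
  rewrite /H -[RHS]comp_mpoly_id; congr (_ \mPo _).
  by apply: eq_from_tnth => j; rewrite !tnth_mktuple mxE addr0.
by rewrite mcoeff_mderiv mnm0E add0m.
Qed.

(** F lies in the square of the maximal ideal of P: if F = 0 is a curve, then P
    is one of its singular points. *)
Definition double_at P F := F.@[P 0] = 0 /\ forall i, (F^`M(i)).@[P 0] = 0.

Lemma double_atD P F G : double_at P F -> double_at P G -> double_at P (F + G).
Proof.
move=> [hF dF] [hG dG]; split=> [|i]; rewrite ?mderivD mevalD ?hF ?hG ?dF ?dG;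
by rewrite addr0.
Qed.

Lemma double_atMr P F G : double_at P G -> double_at P (F * G).
Proof.
by move=> [hG dG]; split=> [|i];
  rewrite ?mderivM ?mevalD !mevalM ?hG ?dG !mulr0 ?addr0.
Qed.

Lemma double_atN P F : double_at P F -> double_at P (- F).
Proof. by move=> h; rewrite -mulN1r; apply: double_atMr. Qed.

Lemma double_atM P F G : F.@[P 0] = 0 -> G.@[P 0] = 0 -> double_at P (F * G).
Proof.
by move=> hF hG; split=> [|i]; rewrite ?mderivM ?mevalD !mevalM ?hF ?hG !(mulr0,
  mul0r, addr0).
Qed.

Lemma vanishes_to_order1 P F : F.@[P 0] = 0 -> vanishes_to_order P F 1.
Proof.
by move=> hF k; rewrite ltnS leqn0 mdeg_eq0 => /eqP ->; rewrite coef0_taylor.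
Qed.

Lemma vanishes_to_order2 P F : double_at P F -> vanishes_to_order P F 2.
Proof.
move=> [hF dF] k; rewrite ltnS leq_eqVlt ltnS leqn0 mdeg_eq0.
by case/orP => [/mdeg1P[i /eqP ->]|/eqP ->];
  rewrite ?coef1_taylor ?coef0_taylor.
Qed.

Lemma vanishes_to_order_le P F m n : (m <= n)%N ->
  vanishes_to_order P F n -> vanishes_to_order P F m.
Proof. by move=> hmn hF k hk; apply: hF; apply: leq_trans hmn. Qed.

End LineRestriction.

(** * Linear forms and divisibility by a line *)
Section LinearForms.
Variable L : closedFieldType.
Implicit Types (F G H Q X Y A B C : {mpoly L[3]}) (P T S : 'rV[L]_3).

Lemma form_neq0 F : F != 0 -> exists P, F.@[P 0] != 0.
Proof.
move=> /meval_neq0[v hv]; exists (\row_i v i).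
by rewrite (meval_eq (v2 := v)) // => i; rewrite mxE.
Qed.

Lemma form_eq0 F : (forall P, F.@[P 0] = 0) -> F = 0.
Proof.
by move=> hF; apply/eqP/negPn/negP => /form_neq0[P]; rewrite hF eqxx.
Qed.

Lemma homog0_const F : F \is 0.-homog -> F = (F@_0%MM)%:MP.
Proof.
move=> hF; apply/mpolyP => m; rewrite mcoeffC; have [->|hm] := eqVneq m 0%MM.
  by rewrite mulr1.
by rewrite mulr0 (dhomog_nemf_coeff hF) // mdeg_eq0.
Qed.

(** Follows from the behaviour on lines through the origin: the restriction to
    zP has no constant term and its linear term is given by the derivatives. *)
Lemma linear_eval X P : X \is 1.-homog ->
  X.@[P 0] = \sum_i X@_(U_(i)%MM) * P 0 i.
Proof.
move=> hX.
have h0 : X.@[(0 : 'rV[L]_3) 0] = 0.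
  rewrite -(coef0_taylor 0); set H := _ \mPo _; have -> : H = X.
    rewrite /H -[RHS]comp_mpoly_id; congr (_ \mPo _).
    by apply: eq_from_tnth => j; rewrite !tnth_mktuple mxE addr0.
  by rewrite (dhomog_nemf_coeff hX) // mf0.
have [hs ht] := restr_homog 0 P hX.
rewrite -ht coef1_restr; apply: eq_bigr => i _; rewrite mulrC; congr (_ * _).
have h1 : X^`M(i) \is 0.-homog.
  apply/dhomogP => m; rewrite mcoeff_msupp mcoeff_mderiv => hm.
  apply/eqP/negPn/negP => hm0; move: hm;
    rewrite (dhomog_nemf_coeff hX) ?mul0rn ?eqxx //.
  by change (mdeg (m + U_(i))%MM != 1%N); rewrite mdegD mdeg1 addn1 eqSS.
by rewrite [X^`M(i)]homog0_const // mevalC mcoeff_mderiv mnm0E add0m.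
Qed.

Lemma linearD X P T : X \is 1.-homog ->
  X.@[(P + T) 0] = X.@[P 0] + X.@[T 0].
Proof.
move=> hX; rewrite !linear_eval // -big_split; apply: eq_bigr => i _ /=.
by rewrite mxE mulrDr.
Qed.

Lemma linearZ_at X P c : X \is 1.-homog -> X.@[(c *: P) 0] = c * X.@[P 0].
Proof.
move=> hX; rewrite !linear_eval // mulr_sumr; apply: eq_bigr => i _ /=.
by rewrite mxE mulrCA.
Qed.

Lemma linear_mpolyE X : X \is 1.-homog -> X = \sum_i (X@_(U_(i)%MM))%:MP * 'X_i.
Proof.
move=> hX; apply/eqP; rewrite -subr_eq0; apply/eqP/form_eq0 => P.
rewrite mevalB linear_eval // rmorph_sum /=; apply/eqP; rewrite subr_eq0;
  apply/eqP.
by apply: eq_bigr => i _; rewrite mevalM mevalC mevalXU.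
Qed.

Lemma linear_neq0 X : X \is 1.-homog -> X != 0 -> exists T, X.@[T 0] = 1.
Proof.
move=> hX; case: (pickP (fun i => X@_(U_(i)%MM) != 0)) => [i hi _|h];
  last first.
  rewrite [X]linear_mpolyE // big1 ?eqxx // => i _.
  by move/negbFE/eqP: (h i) => ->; rewrite mpolyC0 mul0r.
exists ((X@_(U_(i)%MM))^-1 *: delta_mx 0 i).
rewrite linearZ_at // linear_eval // (bigD1 i) //= big1 => [|j hj].
  by rewrite mxE !eqxx mulr1 addr0 mulVf.
by rewrite mxE eqxx /= (negPf hj) mulr0.
Qed.

Lemma linear_span1 A X : A \is 1.-homog -> A != 0 -> X \is 1.-homog ->
  (forall P, A.@[P 0] = 0 -> X.@[P 0] = 0) -> exists c, X = c *: A.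
Proof.
move=> hA A0 hX h; have [T hT] := linear_neq0 hA A0.
exists X.@[T 0]; apply/eqP; rewrite -subr_eq0; apply/eqP/form_eq0 => P.
have := h (P - A.@[P 0] *: T); rewrite -scaleNr !linearD // !linearZ_at // hT.
by rewrite mevalB mevalZ mulr1 subrr => /(_ erefl); rewrite mulNr mulrC.
Qed.

Definition mdvd A F := exists H, F = A * H.

(** When A(T) = 1 this is composition with the projection onto the plane A = 0
    along T.  It is a ring morphism with kernel the ideal of A, which is how
    linear forms are seen to be prime. *)
Definition line_proj A T : {mpoly L[3]} -> {mpoly L[3]} :=
  comp_mpoly [tuple ('X_i - (T 0 i)%:MP * A) | i < 3].
HB.instance Definition _ A T := GRing.RMorphism.copy (line_proj A T)
  (comp_mpoly [tuple ('X_i - (T 0 i)%:MP * A) | i < 3]).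

Lemma line_projP A T F : A \is 1.-homog -> A.@[T 0] = 1 ->
  line_proj A T F = 0 <-> mdvd A F.
Proof.
move=> hA hT.
have pX i : line_proj A T 'X_i = 'X_i - (T 0 i)%:MP * A.
  by rewrite /line_proj comp_mpolyXU -tnth_nth tnth_mktuple.
have pC c : line_proj A T c%:MP = c%:MP by rewrite /line_proj comp_mpolyC.
have pA : line_proj A T A = 0.
  rewrite [X in line_proj A T X]linear_mpolyE // rmorph_sum /=.
  transitivity (A - (A.@[T 0])%:MP * A); last by rewrite hT mpolyC1 mul1r subrr.
  rewrite [X in _ = X - _]linear_mpolyE // linear_eval // rmorph_sum /= mulr_suml -sumrB.
  by apply: eq_bigr => i _; rewrite rmorphM /= pC pX mpolyCM mulrBr mulrA.
have hF G : mdvd A (G - line_proj A T G).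
  elim/mpoly_gen_ind: G => [c|i|G1 G2 [H1 h1] [H2 h2]|G1 G2 [H1 h1] [H2 h2]].
  - by exists 0; rewrite pC subrr mulr0.
  - by exists (T 0 i)%:MP; rewrite pX; ring.
  - by exists (H1 + H2); rewrite rmorphD /= mulrDr -h1 -h2; ring.
  - exists (H1 * G2 + line_proj A T G1 * H2); rewrite rmorphM /= mulrDr.
    by rewrite mulrA -h1 mulrCA -h2; ring.
split=> [h|[H ->]]; last by rewrite rmorphM /= pA mul0r.
by have := hF F; rewrite h subr0.
Qed.

(** Composing with the projection onto A = 0 reduces this to a nonzero
    polynomial taking a nonzero value. *)
Lemma not_mdvd_value A F : A \is 1.-homog -> A != 0 -> ~ mdvd A F ->
  exists P, A.@[P 0] = 0 /\ F.@[P 0] != 0.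
Proof.
move=> hA A0 hF; have [T hT] := linear_neq0 hA A0.
have /form_neq0[P] : line_proj A T F != 0.
  by apply/eqP => /(line_projP F hA hT).
rewrite /line_proj comp_mpoly_meval => hP.
exists (P - A.@[P 0] *: T); split.
  by rewrite -scaleNr linearD // linearZ_at // hT mulr1 subrr.
move: hP; congr (_ != 0).
by apply: meval_eq => i; rewrite tnth_mktuple mevalB mevalM mevalC mevalXU !mxE mulrC.
Qed.

Lemma mdvd_vanish A F : A \is 1.-homog -> A != 0 ->
  (forall P, A.@[P 0] = 0 -> F.@[P 0] = 0) -> mdvd A F.
Proof.
move=> hA A0 hF; have [T hT] := linear_neq0 hA A0.
have [/(line_projP F hA hT)//|h] := eqVneq (line_proj A T F) 0.
have [|P [zA]] := @not_mdvd_value A F hA A0; last by rewrite hF // eqxx.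
by move/(line_projP F hA hT) => h0; rewrite h0 eqxx in h.
Qed.

Lemma mdvd_at A F P : mdvd A F -> A.@[P 0] = 0 -> F.@[P 0] = 0.
Proof. by move=> [H ->] hP; rewrite mevalM hP mul0r. Qed.

Lemma mdvd_prime A F G : A \is 1.-homog -> A != 0 ->
  mdvd A (F * G) -> mdvd A F \/ mdvd A G.
Proof.
move=> hA A0; have [T hT] := linear_neq0 hA A0.
rewrite -!(line_projP _ hA hT) rmorphM /= => /eqP.
by rewrite mulf_eq0 => /orP[] /eqP; [left|right].
Qed.

(** Multiplication by A shifts homogeneous components by one degree. *)
Lemma homog_quotient A H d : A \is 1.-homog -> A != 0 ->
  A * H \is (d.+1).-homog -> H \is d.-homog.
Proof.
move=> hA A0 hAH.
suff -> : H = pihomog mdeg d H by apply: pihomogP.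
apply: (mulfI A0); rewrite -[LHS](pihomog_dE hAH).
rewrite {1}(pihomog_partitionE (mf := mdeg) (leqnn (mmeasure mdeg H))).
rewrite mulr_sumr raddf_sum /=.
have hp e : pihomog mdeg d.+1 (A * pihomog mdeg e H) =
    if e == d then A * pihomog mdeg d H else 0.
  have h : A * pihomog mdeg e H \is (e.+1).-homog.
    by apply: (dhomogM hA); apply: pihomogP.
  case: eqP => [<-|/eqP hed]; first by rewrite pihomog_dE.
  by rewrite (pihomog_ne0 _ h).
under eq_bigr do rewrite hp.
case: (ltnP d (mmeasure mdeg H)) => hd.
  rewrite (bigD1 (Ordinal hd)) //= eqxx big1 ?addr0 // => i hi.
  by case: eqP => // hid; case/eqP: hi; apply: val_inj.
rewrite big1 => [|i _]; last first.
  by case: eqP => // hid; have := ltn_ord i; rewrite hid ltnNge hd.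
rewrite pihomogE big_seq_cond big_pred0 ?mulr0 // => m.
apply/negbTE/negP => /andP[hm /eqP hmd].
by have := mmeasure_mnm_lt mdeg hm; rewrite hmd ltnNge hd.
Qed.

End LinearForms.

(** * Brackets of linear forms *)
Lemma det2 (R : comNzRingType) (M : 'M[R]_2) :
  \det M = M 0 0 * M 1 1 - M 0 1 * M 1 0.
Proof.
rewrite (expand_det_row _ 0) !big_ord_recl big_ord0 /cofactor !det_mx11 !mxE.
rewrite /= /bump /= expr0 expr1 !mul1r addr0 mulN1r mulrN.
by congr (M _ _ * M _ _ - M _ _ * M _ _); apply: val_inj.
Qed.

Lemma det3 (R : comNzRingType) (f : nat -> nat -> R) :
  \det (\matrix_(i < 3, j < 3) f i j) =
  f 0%N 0%N * (f 1%N 1%N * f 2%N 2%N - f 1%N 2%N * f 2%N 1%N)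
  - f 0%N 1%N * (f 1%N 0%N * f 2%N 2%N - f 1%N 2%N * f 2%N 0%N)
  + f 0%N 2%N * (f 1%N 0%N * f 2%N 1%N - f 1%N 1%N * f 2%N 0%N).
Proof.
rewrite (expand_det_row _ 0) !big_ord_recl big_ord0 /cofactor.
by rewrite !det2 !mxE /= /bump /= !addn0 !add0n /=; ring.
Qed.

Section Brackets.
Variable L : closedFieldType.
Implicit Types (F G H Q X Y A B C D : {mpoly L[3]}) (P T S : 'rV[L]_3).

Let u (X : {mpoly L[3]}) (j : nat) : L := X@_(U_(inord j)%MM).

Let bracketE A B C : bracket A B C =
  u A 0 * (u B 1 * u C 2 - u B 2 * u C 1)
  - u A 1 * (u B 0 * u C 2 - u B 2 * u C 0)
  + u A 2 * (u B 0 * u C 1 - u B 1 * u C 0).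
Proof.
rewrite -[RHS](det3 (fun i j => u (nth 0 [:: A; B; C] i) j)) /bracket.
by congr (\det _); apply/matrixP => i j; rewrite !mxE (tnth_nth 0) /u inord_val.
Qed.

Lemma bracket_row1 A B C a b c :
  bracket (a *: A + b *: B + c *: C) B C = a * bracket A B C.
Proof. by rewrite !bracketE /u !mcoeffD !mcoeffZ; ring. Qed.

Lemma bracket_row2 A B C a b c :
  bracket A (a *: A + b *: B + c *: C) C = b * bracket A B C.
Proof. by rewrite !bracketE /u !mcoeffD !mcoeffZ; ring. Qed.

Lemma bracket_row3 A B C a b c :
  bracket A B (a *: A + b *: B + c *: C) = c * bracket A B C.
Proof. by rewrite !bracketE /u !mcoeffD !mcoeffZ; ring. Qed.

Lemma bracket0_zero A B C :
  A \is 1.-homog -> B \is 1.-homog -> C \is 1.-homog -> bracket A B C = 0 ->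
  exists2 P : 'rV[L]_3, P != 0 & [/\ A.@[P 0] = 0, B.@[P 0] = 0 & C.@[P 0] = 0].
Proof.
move=> hA hB hC; rewrite /bracket -det_tr => /eqP/det0P[P P0 hP];
  exists P => //.
have h (k : 'I_3) : (tnth [tuple A; B; C] k) \is 1.-homog ->
    (tnth [tuple A; B; C] k).@[P 0] = 0.
  move=> hi; rewrite linear_eval //; move/matrixP/(_ 0 k): hP;
    rewrite !mxE => e; rewrite -[RHS]e.
  by apply: eq_bigr => j _; rewrite !mxE mulrC.
by split; [have := h 0 | have := h 1 | have := h 2%:R];
  rewrite !(tnth_nth 0) /=; apply.
Qed.

Lemma bracket0_dep A B C :
  A \is 1.-homog -> B \is 1.-homog -> C \is 1.-homog -> bracket A B C = 0 ->
  exists a b c, [|| a != 0, b != 0 | c != 0] /\ a *: A + b *: B + c *: C = 0.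
Proof.
move=> hA hB hC /eqP/det0P[v v0 hv].
exists (v 0 0), (v 0 1), (v 0 2%:R); split.
  apply: contraNT v0; rewrite !negb_or !negbK =>
    /and3P[/eqP h0 /eqP h1 /eqP h2].
  apply/eqP/matrixP => i j; rewrite ord1 mxE.
  case: j => -[|[|[|//]]] hj.
  - by rewrite -h0; congr (v _ _); apply: val_inj.
  - by rewrite -h1; congr (v _ _); apply: val_inj.
  - by rewrite -h2; congr (v _ _); apply: val_inj.
have hs i : v 0 0 * A@_(U_(i)%MM) + v 0 1 * B@_(U_(i)%MM) + v 0 2%:R * C@_(U_(i)%MM) = 0.
  move/matrixP/(_ 0 i): hv; rewrite !mxE !big_ord_recl big_ord0 !mxE !(tnth_nth 0) /= addr0 addrA => e; rewrite -[RHS]e.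
  by congr (_ + _ * _ + _ * _); congr (v _ _); apply: val_inj.
rewrite [A]linear_mpolyE // [B]linear_mpolyE // [C]linear_mpolyE //.
rewrite !scaler_sumr -!big_split big1 // => i _ /=.
rewrite -!mul_mpolyC !mulrA -!mpolyCM -!mulrDl -!mpolyCD.
by rewrite hs mpolyC0 mul0r.
Qed.

Lemma bracket_common_zero A B C P :
  A \is 1.-homog -> B \is 1.-homog -> C \is 1.-homog -> P != 0 ->
  A.@[P 0] = 0 -> B.@[P 0] = 0 -> C.@[P 0] = 0 -> bracket A B C = 0.
Proof.
move=> hA hB hC P0 zA zB zC; rewrite /bracket -det_tr; apply/eqP/det0P;
  exists P => //.
apply/matrixP => i j; rewrite ord1 !mxE.
have h (k : 'I_3) : (tnth [tuple A; B; C] k) \is 1.-homog ->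
  (tnth [tuple A; B; C] k).@[P 0] = 0 ->
   \sum_j P 0 j * (tnth [tuple A; B; C] k)@_(U_(j)%MM) = 0.
  by move=> hi; rewrite linear_eval // => e; rewrite -[RHS]e;
    apply: eq_bigr => l _; rewrite mulrC.
under eq_bigr do rewrite !mxE.
by case: j => -[|[|[|//]]] hj; apply: h; rewrite (tnth_nth 0).
Qed.

Lemma lines_meet A B : A \is 1.-homog -> B \is 1.-homog ->
  exists2 P : 'rV[L]_3, P != 0 & A.@[P 0] = 0 /\ B.@[P 0] = 0.
Proof.
move=> hA hB; have [||||P P0 [h1 h2 _]] := @bracket0_zero A B B => //.
  by rewrite !bracketE; ring.
by exists P.
Qed.

Lemma proportional_sym F G : proportional F G -> proportional G F.
Proof.
by move=> [c c0 ->]; exists c^-1; rewrite ?invr_eq0 // scalerA mulVf // scale1r.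
Qed.

Lemma proportional_trans F G H :
  proportional F G -> proportional G H -> proportional F H.
Proof.
by move=> [c c0 ->] [d d0 ->]; exists (c * d); rewrite ?mulf_neq0 // scalerA.
Qed.

Lemma mdvd_proportional A B : A \is 1.-homog -> A != 0 -> B \is 1.-homog ->
  B != 0 -> mdvd A B -> proportional A B.
Proof.
move=> hA A0 hB B0 [H hH]; apply: proportional_sym.
have h0 : H \is 0.-homog by apply: (homog_quotient hA A0); rewrite -hH.
have := homog0_const h0; set c := _@__ => hc; exists c.
  by apply: contraNneq B0 => c0; rewrite hH hc c0 mpolyC0 mulr0.
by rewrite hH hc mulrC mul_mpolyC.
Qed.

Lemma mdvdM A B F : B \is 1.-homog -> B != 0 -> A \is 1.-homog -> A != 0 ->
  ~ proportional A B -> mdvd B (A * F) -> mdvd B F.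
Proof.
move=> hB B0 hA A0 hAB /(mdvd_prime hB B0)[] // h.
by case: hAB; apply: proportional_sym; apply: mdvd_proportional.
Qed.

(** Lines through the intersection point of A and B form the pencil spanned
    by A and B. *)
Lemma meet_span A B C P : A \is 1.-homog -> A != 0 -> B \is 1.-homog ->
  B != 0 -> C \is 1.-homog -> ~ proportional A B -> P != 0 -> A.@[P 0] = 0 ->
    B.@[P 0] = 0 ->
  C.@[P 0] = 0 -> exists a b, C = a *: A + b *: B.
Proof.
move=> hA A0 hB B0 hC hAB P0 zA zB zC.
have [a [b [c [habc]]]] := bracket0_dep hA hB hC (bracket_common_zero hA hB hC P0 zA zB zC).
have [c0|c0 e] := eqVneq c 0.
  rewrite c0 scale0r addr0 => e; case: hAB.
  have a0 : a != 0.
    apply: contraTneq habc => a0; move: e; rewrite a0 scale0r add0r => /eqP.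
    by rewrite scaler_eq0 (negPf B0) orbF c0 eqxx => /eqP ->; rewrite eqxx.
  exists (- (b / a)).
    rewrite oppr_eq0 mulf_neq0 ?invr_eq0 //; apply: contraTneq A0 => b0.
    by move/eqP: e; rewrite b0 scale0r addr0 scaler_eq0 (negPf a0) negbK.
  apply: (scalerI a0); rewrite scalerA; apply/eqP; rewrite -subr_eq0 -e.
  by apply/eqP; congr (_ + _); rewrite -scaleNr; congr (_ *: _); field.
exists (- (a / c)), (- (b / c)); apply: (scalerI c0); rewrite scalerDr !scalerA.
apply/eqP; rewrite -subr_eq0 -[X in _ == X]e; apply/eqP.
rewrite opprD -!scaleNr addrC; congr (_ + _); congr (_ *: _ + _ *: _); field;
  exact: c0.
Qed.
End Brackets.

(** * Equations of a smooth quartic in terms of lines *)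

(** Symmetric in a, b, c: it is a^2 + b^2 + c^2 - 2ab - 2bc - 2ca, which vanishes
    exactly when sqrt a + sqrt b + sqrt c = 0 for some choice of the roots. *)
Definition riemann_form (R : comNzRingType) (a b c : R) : R :=
  (a + b - c) ^+ 2 - 4%:R * (a * b).

Section SmoothQuartic.
Variable L : closedFieldType.
Implicit Types (F G H X Y A B C D E : {mpoly L[3]}) (P T S : 'rV[L]_3).
Hypothesis two_neq0 : 2%:R != 0 :> L.
Variable Q : {mpoly L[3]}.
Hypothesis Q_smooth : nonsingular Q.

Definition linear_form X := X \is 1.-homog /\ X != 0.

Lemma smooth_not_double P : P != 0 -> ~ double_at P Q.
Proof.
move=> P0 [hQ dQ]; have [//|i] := Q_smooth (P := P).
by rewrite /eval_at dQ eqxx.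
Qed.

(** The source of the nondegeneracy statements below: G, E, F cannot vanish
    together, for G^2 and EF would both be in the square of the maximal ideal. *)
Lemma smooth_form_at P G c E F : Q = G ^+ 2 - c%:MP * (E * F) -> P != 0 ->
  G.@[P 0] = 0 -> E.@[P 0] = 0 -> F.@[P 0] = 0 -> False.
Proof.
move=> hQ P0 hG hE hF; apply: (smooth_not_double P0); rewrite hQ expr2.
by apply: double_atD; [|apply/double_atN/double_atMr]; apply: double_atM.
Qed.

Lemma riemann_form_smooth P E0 E1 E2 : Q = riemann_form E0 E1 E2 -> P != 0 ->
  E0.@[P 0] = 0 -> E1.@[P 0] = 0 -> E2.@[P 0] = 0 -> False.
Proof.
move=> hQ P0 h0 h1 h2; apply: (smooth_form_at (G := E0 + E1 - E2) (c :=
  4%:R) (E := E0) (F := E1) _ P0) => //.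
  by rewrite hQ /riemann_form; ring.
by rewrite mevalB mevalD h0 h1 h2; ring.
Qed.

(** If A divides G1 - G2, then so does B: otherwise B divides G1 + G2, and Q is
    singular where A and B meet.  Hence G1 - G2 = s AB, which makes it possible
    to eliminate G2. *)
Let three_pairs_sign A B E1 E2 G1 G2 c1 c2 :
  linear_form A -> linear_form B -> ~ proportional A B ->
  G1 \is 2.-homog -> G2 \is 2.-homog -> c1 != 0 -> c2 != 0 ->
  Q = G1 ^+ 2 - c1%:MP * (A * B * E1) -> Q = G2 ^+ 2 - c2%:MP * (A * B * E2) ->
  ~ proportional E1 E2 -> mdvd A (G1 - G2) ->
  exists a b c, [/\ a != 0, b != 0, c != 0 &
   Q = riemann_form (a%:MP * (A * B)) (b%:MP * E1) (c%:MP * E2)].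
Proof.
move=> [hA A0] [hB B0] hAB hG1 hG2 c10 c20 hQ1 hQ2 hE hd.
have e : (G1 - G2) * (G1 + G2) = A * B * (c1%:MP * E1 - c2%:MP * E2).
  transitivity (Q + c1%:MP * (A * B * E1) - (Q + c2%:MP * (A * B * E2)));
    last by ring.
  by rewrite {1}hQ1 hQ2; ring.
have hdB : mdvd B (G1 - G2).
  have : mdvd B ((G1 - G2) * (G1 + G2)).
    by exists (A * (c1%:MP * E1 - c2%:MP * E2)); rewrite e; ring.
  (* If B divided the other factor, G1 would vanish where A and B meet. *)
  case/(mdvd_prime hB B0) => // hs; exfalso.
  have [P P0 [zA zB]] := lines_meet hA hB.
  have := mdvd_at hd zA; have := mdvd_at hs zB; rewrite mevalB mevalD => h1 h2.
  have zG : G1.@[P 0] = 0.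
    apply: (mulfI two_neq0); rewrite mulr0 -[RHS](addr0 0) -{1}h1 -h2; ring.
  apply: (smooth_form_at (G := G1) (c := c1) (E := A) (F := B * E1) _ P0) => //.
    by rewrite hQ1; ring.
  by rewrite mevalM zB mul0r.
have [H hH] := hd.
have [t ht] : mdvd B H by apply: (@mdvdM _ A) => //; rewrite -hH.
have hAB2 : A * (B * t) \is 2.-homog.
  by rewrite -ht -hH; apply: rpredB.
have ht0 : t \is 0.-homog by apply: (homog_quotient hB B0);
  apply: (homog_quotient hA A0).
have := homog0_const ht0; set s := _@__ => hs.
have e2 : G1 - G2 = s%:MP * (A * B) by rewrite hH ht hs; ring.
have AB0 : A * B != 0 by rewrite mulf_neq0.
(* Cancel AB in G1^2 - G2^2, where G2 = G1 - s AB. *)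
have e3 : (2%:R * s)%:MP * G1 =
  (s ^+ 2)%:MP * (A * B) + c1%:MP * E1 - c2%:MP * E2.
  apply: (mulfI AB0); rewrite -addrA mulrDr -e.
  have -> : G2 = G1 - s%:MP * (A * B) by rewrite -e2; ring.
  by ring.
have s0 : s != 0.
  apply: contra_notN hE => /eqP s0; exists (c2 / c1);
    first by rewrite mulf_neq0 ?invr_eq0.
  apply: (scalerI c10); rewrite scalerA mulrCA divff // mulr1 -!mul_mpolyC.
  move: e3; rewrite s0 mulr0 expr0n !mpolyC0 !mul0r add0r => /eqP.
  by rewrite eq_sym subr_eq0 => /eqP.
have ts0 : 2%:R * s != 0 by rewrite mulf_neq0.
exists (s ^+ 2 / (2%:R * s)), (c1 / (2%:R * s)), (c2 / (2%:R * s)).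
split; rewrite ?mulf_neq0 ?invr_eq0 ?expf_neq0 //.
have ti : ((2%:R * s)^-1)%:MP * (2%:R * s)%:MP = 1 :> {mpoly L[3]}.
  by rewrite -mpolyCM mulVf.
have -> : Q = ((2%:R * s)^-1)%:MP ^+ 2 * ((2%:R * s)%:MP ^+ 2 * Q).
  by rewrite mulrA -exprMn ti expr1n mul1r.
have -> : (2%:R * s)%:MP ^+ 2 * Q =
  riemann_form ((s ^+ 2)%:MP * (A * B)) (c1%:MP * E1) (c2%:MP * E2).
  by rewrite /riemann_form -e3 hQ1; ring.
by rewrite /riemann_form !mpolyCM; ring.
Qed.

Lemma three_pairs A B E1 E2 G1 G2 c1 c2 :
  linear_form A -> linear_form B -> ~ proportional A B ->
  G1 \is 2.-homog -> G2 \is 2.-homog -> c1 != 0 -> c2 != 0 ->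
  Q = G1 ^+ 2 - c1%:MP * (A * B * E1) -> Q = G2 ^+ 2 - c2%:MP * (A * B * E2) ->
  ~ proportional E1 E2 ->
  exists a b c, [/\ a != 0, b != 0, c != 0 &
   Q = riemann_form (a%:MP * (A * B)) (b%:MP * E1) (c%:MP * E2)].
Proof.
move=> lA lB hAB hG1 hG2 c10 c20 hQ1 hQ2 hE.
have : mdvd A ((G1 - G2) * (G1 + G2)).
  exists (B * (c1%:MP * E1 - c2%:MP * E2)).
  transitivity (Q + c1%:MP * (A * B * E1) - (Q + c2%:MP * (A * B * E2)));
    last by ring.
  by rewrite {1}hQ1 hQ2; ring.
case/(mdvd_prime lA.1 lA.2) => h.
  by apply: (three_pairs_sign lA lB hAB hG1 hG2 c10 c20).
apply: (three_pairs_sign lA lB hAB hG1 (G2 := - G2) _ c10 c20) => //.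
- by rewrite rpredN.
- by rewrite hQ2; ring.
by rewrite opprK.
Qed.

Lemma two_lines_quotient A B F : linear_form A -> linear_form B ->
  ~ proportional A B -> F \is 2.-homog -> mdvd A F -> mdvd B F ->
  exists t, F = t%:MP * (A * B).
Proof.
move=> [hA A0] [hB B0] hAB hF [H hH] hBF.
have [K hK] : mdvd B H by apply: (@mdvdM _ A) => //; rewrite -hH.
have hK0 : K \is 0.-homog.
  by apply: (homog_quotient hB B0); apply: (homog_quotient hA A0);
    rewrite -hK -hH.
by exists K@_0%MM; rewrite -homog0_const // hH hK; ring.
Qed.

Lemma three_lines_quadric A B C F : linear_form A -> linear_form B ->
  linear_form C -> ~ proportional A B -> ~ proportional A C ->
  ~ proportional B C -> F \is 2.-homog -> mdvd A F -> mdvd B F -> mdvd C F ->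
  F = 0.
Proof.
move=> lA lB [hC C0] nAB nAC nBC hF dA dB.
have [t ->] := two_lines_quotient lA lB nAB hF dA dB.
have [hA A0] := lA; have [hB B0] := lB.
have -> : t%:MP * (A * B) = A * (B * t%:MP) by ring.
move=> /(mdvdM hC C0 hA A0 nAC) /(mdvdM hC C0 hB B0 nBC) [H hH].
have [t0|t0] := eqVneq t 0; first by rewrite t0 mpolyC0 !mulr0.
have [P P0 [zC _]] := lines_meet hC hC.
have := mdvd_at (ex_intro _ H hH) zC; rewrite mevalC => /eqP.
by rewrite (negPf t0).
Qed.

(** The squares of the two conics u and v differ by a multiple of X1Y1X2Y2.  Two
    of these lines dividing different factors of (u - v)(u + v) would meet in a
    common zero of u and v, which is a singular point; so all of them divide
    the same factor, of degree two, and this factor is zero. *)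
Lemma opposite_pairs X1 Y1 X2 Y2 E3 E7 a1 a2 a3 b1 b2 b3 :
  linear_form X1 -> linear_form Y1 -> linear_form X2 -> linear_form Y2 ->
  ~ proportional X1 Y1 -> ~ proportional X1 X2 -> ~ proportional X2 Y1 ->
  E3 \is 2.-homog -> E7 \is 2.-homog ->
  Q = riemann_form (a1%:MP * (X1 * Y1)) (a2%:MP * (X2 * Y2)) (a3%:MP * E3) ->
  Q = riemann_form (b1%:MP * (X1 * Y2)) (b2%:MP * (X2 * Y1)) (b3%:MP * E7) ->
  exists e : L, [/\ e ^+ 2 = 1, a1 * a2 = b1 * b2 &
   a1%:MP * (X1 * Y1) + a2%:MP * (X2 * Y2) - a3%:MP * E3 =
   e%:MP * (b1%:MP * (X1 * Y2) + b2%:MP * (X2 * Y1) - b3%:MP * E7)].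
Proof.
move=> lX1 lY1 lX2 lY2 n1 n12 n21 hE3 hE7 hQu hQv.
have hM Z W c : linear_form Z -> linear_form W -> c%:MP * (Z * W) \is 2.-homog.
  by move=> [hZ _] [hW _]; rewrite mul_mpolyC; apply/rpredZ/(dhomogM hZ hW).
have hC c E : E \is 2.-homog -> c%:MP * E \is 2.-homog.
  by move=> hE; rewrite mul_mpolyC; apply: rpredZ.
have hu : a1%:MP * (X1 * Y1) + a2%:MP * (X2 * Y2) - a3%:MP * E3 \is 2.-homog.
  by apply: rpredB; [apply: rpredD|]; auto.
have hv : b1%:MP * (X1 * Y2) + b2%:MP * (X2 * Y1) - b3%:MP * E7 \is 2.-homog.
  by apply: rpredB; [apply: rpredD|]; auto.
move: hu hv; set u := _ + _ - _; set v := _ + _ - b3%:MP * _ => hu hv.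
pose p := X1 * Y1 * X2 * Y2.
have eu : Q = u ^+ 2 - (4%:R * a1 * a2)%:MP * p
  by rewrite hQu /riemann_form /u /p; ring.
have ev : Q = v ^+ 2 - (4%:R * b1 * b2)%:MP * p
  by rewrite hQv /riemann_form /v /p; ring.
have uv : u ^+ 2 - v ^+ 2 = (4%:R * (a1 * a2 - b1 * b2))%:MP * p.
  have -> : u ^+ 2 = Q + (4%:R * a1 * a2)%:MP * p by rewrite eu; ring.
  have -> : v ^+ 2 = Q + (4%:R * b1 * b2)%:MP * p by rewrite ev; ring.
  by ring.
have uve e : e ^+ 2 = 1 -> (u - e%:MP * v) * (u + e%:MP * v) =
    (4%:R * (a1 * a2 - b1 * b2))%:MP * p.
  move=> he; rewrite -uv; transitivity (u ^+ 2 - (e ^+ 2)%:MP * v ^+ 2);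
    first by ring.
  by rewrite he mpolyC1 mul1r.
(* Lines occurring in p divide the same one of u - ev and u + ev. *)
have hp A B r e : e ^+ 2 = 1 -> linear_form A -> linear_form B ->
  p = A * B * r ->
    mdvd A (u - e%:MP * v) -> mdvd B (u - e%:MP * v).
  move=> he [hA A0] [hB B0] hpr dA.
  have : mdvd B ((u - e%:MP * v) * (u + e%:MP * v)).
    by exists ((4%:R * (a1 * a2 - b1 * b2))%:MP * A * r); rewrite uve // hpr;
      ring.
  case/(mdvd_prime hB B0) => // hs; exfalso.
  have [P P0 [zA zB]] := lines_meet hA hB.
  have := mdvd_at dA zA; have := mdvd_at hs zB; rewrite mevalB mevalD => h1 h2.
  apply: (smooth_form_at (G := u) (c := 4%:R * a1 * a2) (E := A) (F :=
    B * r) _ P0) => //.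
  - by rewrite eu hpr; ring.
  - by apply: (mulfI two_neq0); rewrite mulr0 -[RHS](addr0 0) -{1}h1 -h2; ring.
  - by rewrite mevalM zB mul0r.
have he e : e ^+ 2 = 1 -> mdvd X1 (u - e%:MP * v) -> u = e%:MP * v.
  move=> he d1; apply/eqP; rewrite -subr_eq0; apply/eqP.
  apply: (three_lines_quadric lX1 lX2 lY1) => //.
  - by apply: rpredB => //; apply: hC.
  - by apply: (hp X1 X2 (Y1 * Y2) e) => //; rewrite /p; ring.
  - by apply: (hp X1 Y1 (X2 * Y2) e) => //; rewrite /p; ring.
have [e e1 ue] : exists2 e : L, e ^+ 2 = 1 & u = e%:MP * v.
  have : mdvd X1 ((u - (1 : L)%:MP * v) * (u + (1 : L)%:MP * v)).
    exists ((4%:R * (a1 * a2 - b1 * b2))%:MP * Y1 * X2 * Y2).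
    by rewrite uve ?expr1n // /p; ring.
  case/(mdvd_prime lX1.1 lX1.2) => h; [exists 1|exists (-1)];
    rewrite ?sqrrN ?expr1n //.
    by apply: he; rewrite ?expr1n.
  by apply: he; rewrite ?sqrrN ?expr1n // mpolyCN mulNr opprK.
exists e; split=> //.
have p0 : p != 0 by rewrite /p !mulf_neq0 // ?lX1.2 ?lX2.2 ?lY1.2 ?lY2.2.
have := uve e e1; rewrite ue subrr mul0r => /esym/eqP.
rewrite mulf_eq0 (negPf p0) orbF mpolyC_eq0 -[4%N]/(2 * 2)%N natrM !mulf_eq0.
by rewrite (negPf two_neq0) /= subr_eq0 => /eqP.
Qed.
End SmoothQuartic.

(** * The seventh line *)
Section RiemannModel.
Variable L : closedFieldType.
Implicit Types (F G H X Y A B C D E : {mpoly L[3]}) (P T S : 'rV[L]_3).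

Lemma proportional_mul_same_pair X Y Z W : linear_form X -> linear_form Y ->
  linear_form Z -> linear_form W -> proportional (X * Y) (Z * W) ->
    same_pair X Y Z W.
Proof.
move=> [hX X0] [hY Y0] [hZ Z0] [hW W0] [c c0 e].
have key V V' : V \is 1.-homog -> V != 0 -> V' \is 1.-homog -> V' != 0 ->
    X * Y = c *: (V * V') -> mdvd X V -> proportional X V /\ proportional Y V'.
  move=> hV V0 hV' V'0 eV /(mdvd_proportional hX X0 hV V0) pXV; split=> //.
  have [d d0 hd] := pXV; exists (c / d); first by rewrite mulf_neq0 ?invr_eq0.
  apply: (mulfI X0); rewrite eV hd -!mul_mpolyC.
  have -> : c%:MP = (c / d)%:MP * d%:MP :> {mpoly L[3]}
    by rewrite -mpolyCM mulfVK.
  by ring.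
have /(mdvd_prime hX X0) : mdvd X (Z * W).
  exists (c^-1 *: Y); apply: (scalerI c0); rewrite -e -!mul_mpolyC.
  by rewrite mulrCA [c%:MP * _]mulrA -mpolyCM divff // mpolyC1 mul1r.
case=> h; [left|right]; first exact: key h.
by apply: key h => //; rewrite [W * Z]mulrC.
Qed.

Lemma bracket_free A B C (a b c : L) : bracket A B C != 0 ->
  a%:MP * A + b%:MP * B + c%:MP * C = 0 -> [/\ a = 0, b = 0 & c = 0].
Proof.
rewrite !mul_mpolyC => hb e.
have b1 := bracket_row1 A B C a b c; have b2 := bracket_row2 A B C a b c.
have b3 := bracket_row3 A B C a b c; rewrite {}e in b1 b2 b3.
have z X Y : [/\ bracket 0 X Y = 0, bracket X 0 Y = 0 & bracket X Y 0 = 0].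
  split.
  - by have := bracket_row1 0 X Y 0 0 0; rewrite !scale0r !addr0 mul0r.
  - by have := bracket_row2 X 0 Y 0 0 0; rewrite !scale0r !addr0 mul0r.
  - by have := bracket_row3 X Y 0 0 0 0; rewrite !scale0r !addr0 mul0r.
have [zA _ _] := z B C; have [_ zB _] := z A C; have [_ _ zC] := z A B.
split; apply/eqP.
- by have := b1; rewrite zA => /esym/eqP; rewrite mulf_eq0 (negPf hb) orbF.
- by have := b2; rewrite zB => /esym/eqP; rewrite mulf_eq0 (negPf hb) orbF.
- by have := b3; rewrite zC => /esym/eqP; rewrite mulf_eq0 (negPf hb) orbF.
Qed.

(** At the point where X3 and X7 meet, one of l and m vanishes, so it is a
    combination e X7 + f X3; cancelling X3 modulo X7 then puts X7 in the span
    of Y3 and the other factor. *)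
Lemma pencil_split l m X3 Y3 X7 Y7 (g c : L) :
  l \is 1.-homog -> m \is 1.-homog -> linear_form X3 -> Y3 \is 1.-homog ->
  linear_form X7 -> ~ proportional X3 X7 ->
  l * m = g%:MP * (X3 * Y3) - c%:MP * (X7 * Y7) ->
  exists e f f' : L,
    (l = e%:MP * X7 + f%:MP * X3 /\ g%:MP * Y3 - f%:MP * m = f'%:MP * X7) \/
    (m = e%:MP * X7 + f%:MP * X3 /\ g%:MP * Y3 - f%:MP * l = f'%:MP * X7).
Proof.
move=> hl hm [h3 X30] hY [h7 X70] n37 elm.
have key l' m' : l' \is 1.-homog -> m' \is 1.-homog -> l' * m' = l * m ->
   (exists2 P : 'rV[L]_3, P != 0 & [/\ X3.@[P 0] = 0,
     X7.@[P 0] = 0 & l'.@[P 0] = 0]) ->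
   exists e f f' : L,
    (l' = e%:MP * X7 + f%:MP * X3 /\ g%:MP * Y3 - f%:MP * m' = f'%:MP * X7).
  move=> hl' hm' e' [P P0 [z3 z7 zl]].
  have [f [e el]] := meet_span h3 X30 h7 X70 hl' n37 P0 z3 z7 zl.
  have hh : g%:MP * Y3 - f%:MP * m' \is 1.-homog.
    by rewrite !mul_mpolyC; apply: rpredB; apply: rpredZ.
  have [H hH] : mdvd X7 (g%:MP * Y3 - f%:MP * m').
    apply: (@mdvdM _ X3) => //; exists (e%:MP * m' + c%:MP * Y7).
    transitivity ((l' - f%:MP * X3) * m' + c%:MP * (X7 * Y7)).
      by rewrite mulrBl e' elm; ring.
    by rewrite el -!mul_mpolyC; ring.
  have H0 : H \is 0.-homog by apply: (homog_quotient h7 X70); rewrite -hH.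
  exists e, f, H@_0%MM; split; first by rewrite el !mul_mpolyC addrC.
  by rewrite -homog0_const // hH mulrC.
have [P P0 [z3 z7]] := lines_meet h3 h7.
have : l.@[P 0] * m.@[P 0] = 0.
  by rewrite -mevalM elm mevalB !mevalM z3 z7 !(mul0r, mulr0) subrr.
move/eqP; rewrite mulf_eq0 => /orP[] /eqP z.
  by have [|e [f [f' h]]] := key l m hl hm erefl; [exists P|exists e, f, f';
    left].
have [|e [f [f' h]]] := key m l hm hl (mulrC _ _); first by exists P.
by exists e, f, f'; right.
Qed.

(** In Riemann's model of a plane quartic, with x1 + x2 + x3 + z1 + z2 + z3 = 0,
    the form t = x1 + x2 + x3 is again a bitangent, and it is syzygetic with
    x1 and z3. *)
Lemma riemann_identity (R : comNzRingType) (x1 x2 x3 z1 z2 z3 t : R) :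
  t = x1 + x2 + x3 -> t = - (z1 + z2 + z3) ->
  riemann_form (x1 * z1) (x2 * z2) (x3 * z3) =
  (x1 * z3 - x3 * z1 - t * (x1 + x3 + z2)) ^+ 2 + 4%:R * (x1 * z3 * t * (x1 + x3 + z2)).
Proof.
move=> h1 h2.
have -> : x2 = t - x1 - x3 by rewrite h1; ring.
have -> : z2 = - t - z1 - z3 by rewrite {1}h2; ring.
by rewrite /riemann_form; ring.
Qed.

Section Lines.
Variables (Q : {mpoly L[3]}).
Variables X1 Y1 X2 Y2 X3 Y3 X7 Y7 : {mpoly L[3]}.
Hypotheses (lX1 : linear_form X1) (lY1 : linear_form Y1).
Hypotheses (lX2 : linear_form X2) (lY2 : linear_form Y2).
Hypotheses (lX3 : linear_form X3) (lY3 : linear_form Y3).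
Hypotheses (lX7 : linear_form X7).
Variables a1 a2 a3 b1 b2 b3 : L.
Hypotheses (a10 : a1 != 0) (a30 : a3 != 0).
Hypothesis hQ :
  Q = riemann_form (a1%:MP * (X1 * Y1)) (a2%:MP * (X2 * Y2)) (a3%:MP * (X3 * Y3)).
Hypothesis hab : a1 * a2 = b1 * b2.
Hypothesis huv : a1%:MP * (X1 * Y1) + a2%:MP * (X2 * Y2) - a3%:MP * (X3 * Y3) =
   b1%:MP * (X1 * Y2) + b2%:MP * (X2 * Y1) - b3%:MP * (X7 * Y7).
Hypothesis n37 : ~ proportional X3 X7.
Hypotheses (bX : bracket X1 X2 X3 != 0) (bY : bracket Y1 Y2 Y3 != 0).
Hypotheses (bX' : bracket X1 X2 Y3 != 0) (bY' : bracket Y1 Y2 X3 != 0).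
Hypotheses (b7 : bracket X1 X2 X7 != 0) (b7' : bracket Y1 Y2 X7 != 0).

(** The hypothesis [huv] factors as l m = a3 X3Y3 - b3 X7Y7 because
    a1a2 = b1b2.  Of the two outcomes of [pencil_split], the first gives the
    two expressions of X7, and the second gives those of [riemann_identity]
    with X3 and Y3 exchanged; independence of the lines makes e, f and f'
    nonzero. *)
Lemma seventh_line :
  (exists r1 r2 r3 s1 s2 s3 t : L, [/\ t != 0,
     X7 = r1 *: X1 + r2 *: X2 + r3 *: X3, X7 = s1 *: Y1 + s2 *: Y2 + s3 *: Y3 &
     [/\ r1 * s1 = t * a1, r2 * s2 = t * a2 & r3 * s3 = t * a3]]) \/
  (exists U W, U \is 2.-homog /\ Q = U ^+ 2 - X1 * X3 * X7 * W).
Proof.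
have [h1 _] := lX1; have [h2 _] := lX2; have [h3 _] := lX3.
have [k1 _] := lY1; have [k2 _] := lY2; have [k3 _] := lY3; have [h7 _] := lX7.
pose l := a1%:MP * X1 - b2%:MP * X2.
pose m := Y1 - (b1 / a1)%:MP * Y2.
have hl : l \is 1.-homog by rewrite /l !mul_mpolyC; apply: rpredB;
  apply: rpredZ.
have hm : m \is 1.-homog by rewrite /m !mul_mpolyC; apply: rpredB => //;
  apply: rpredZ.
have ea : a1%:MP * (b1 / a1)%:MP = b1%:MP :> {mpoly L[3]}.
  by rewrite -mpolyCM; congr _%:MP; field.
have ea2 : b2%:MP * (b1 / a1)%:MP = a2%:MP :> {mpoly L[3]}.
  rewrite -mpolyCM; congr _%:MP; apply: (mulfI a10); rewrite hab; field;
    exact: a10.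
have elm : l * m = a3%:MP * (X3 * Y3) - b3%:MP * (X7 * Y7).
  transitivity (a1%:MP * (X1 * Y1) + a2%:MP * (X2 * Y2) - b1%:MP * (X1 * Y2) - b2%:MP * (X2 * Y1)).
    by rewrite -ea -ea2 /l /m; ring.
  rewrite -[X in X - _ - _](subrK (a3%:MP * (X3 * Y3))) huv; ring.
have [e [f [f' [[el ef]|[em ef]]]]] := pencil_split hl hm lX3 k3 lX7 n37 elm;
  [left|right].
- have e0 : e != 0.
    apply/negP => /eqP z; move: el; rewrite z mpolyC0 mul0r add0r /l => el.
    have [|/eqP] := @bracket_free X1 X2 X3 a1 (- b2) (- f) bX;
      last by rewrite (negPf a10).
    by rewrite !mpolyCN !mulNr el subrr.
  have f0 : f != 0.
    apply/negP => /eqP z; move: el; rewrite z mpolyC0 mul0r addr0 /l => el.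
    have [|/eqP] := @bracket_free X1 X2 X7 a1 (- b2) (- e) b7;
      last by rewrite (negPf a10).
    by rewrite !mpolyCN !mulNr el subrr.
  have f'0 : f' != 0.
    apply/negP => /eqP z; move: ef; rewrite z mpolyC0 mul0r /m => ef.
    have [|_ _ /eqP] := @bracket_free Y1 Y2 Y3 (- f) (f * (b1 / a1)) a3 bY;
      last by rewrite (negPf a30).
    by rewrite -ef; ring.
  exists (a1 / e), (- (b2 / e)), (- (f / e)), (- (f / f')),
    (f * b1 / (a1 * f')), (a3 / f').
  exists (- (f / (e * f'))); split.
  + by rewrite oppr_eq0 !mulf_neq0 ?invr_eq0 ?mulf_neq0.
  + apply: (scalerI e0); rewrite !scalerDr !scalerA -!mul_mpolyC.
    have -> : e * (a1 / e) = a1 by field.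
    have -> : e * - (b2 / e) = - b2 by field.
    have -> : e * - (f / e) = - f by field.
    have -> : e%:MP * X7 = l - f%:MP * X3 by rewrite el; ring.
    by rewrite /l; ring.
  + apply: (scalerI f'0); rewrite !scalerDr !scalerA -!mul_mpolyC -ef /m.
    have -> : f' * - (f / f') = - f by field.
    have -> : f' * (f * b1 / (a1 * f')) = f * (b1 / a1) by field;
      rewrite a10 f'0.
    have -> : f' * (a3 / f') = a3 by field.
    by ring.
  split.
  + by field; rewrite e0 f'0.
  + rewrite (_ : _ * _ = - (f * (b1 * b2) / (e * a1 * f'))); last by field;
    rewrite a10 e0 f'0.
    by rewrite -hab; field; rewrite a10 e0 f'0.
  + by field; rewrite e0 f'0.
have e0 : e != 0.
  apply/negP => /eqP z; move: em; rewrite z mpolyC0 mul0r add0r /m => em.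
  have [|/eqP] := @bracket_free Y1 Y2 X3 1 (- (b1 / a1)) (- f) bY';
    last by rewrite oner_eq0.
  by rewrite !mpolyCN !mulNr mpolyC1 mul1r em subrr.
have f0 : f != 0.
  apply/negP => /eqP z; move: em; rewrite z mpolyC0 mul0r addr0 /m => em.
  have [|/eqP] := @bracket_free Y1 Y2 X7 1 (- (b1 / a1)) (- e) b7';
    last by rewrite oner_eq0.
  by rewrite !mpolyCN !mulNr mpolyC1 mul1r em subrr.
have f'0 : f' != 0.
  apply/negP => /eqP z; move: ef; rewrite z mpolyC0 mul0r /l => ef.
  have [|_ _ /eqP] := @bracket_free X1 X2 Y3 (- (f * a1)) (f * b2) a3 bX';
    last by rewrite (negPf a30).
  by rewrite -ef; ring.
(* The two expressions of X7, scaled so that t = X7 in [riemann_identity]. *)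
pose x1 := (- (f * a1 / f'))%:MP * X1; pose x2 := (f * b2 / f')%:MP * X2.
pose x3 := (a3 / f')%:MP * Y3.
pose z1 := (- e^-1)%:MP * Y1; pose z2 := (b1 / (a1 * e))%:MP * Y2;
  pose z3 := (f / e)%:MP * X3.
have i1 : f'^-1%:MP * f'%:MP = 1 :> {mpoly L[3]} by rewrite -mpolyCM mulVf.
have i2 : e^-1%:MP * e%:MP = 1 :> {mpoly L[3]} by rewrite -mpolyCM mulVf.
have ex : X7 = x1 + x2 + x3.
  rewrite -[LHS]mul1r -i1 -mulrA -ef /x1 /x2 /x3 /l; ring.
have ez : X7 = - (z1 + z2 + z3).
  rewrite -[LHS]mul1r -i2 -mulrA (_ : e%:MP * X7 = m - f%:MP * X3);
    last by rewrite em; ring.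
  by rewrite /m /z1 /z2 /z3 invfM; ring.
pose t := f / (e * f').
have t0 : t != 0 by rewrite /t mulf_neq0 ?invr_eq0 ?mulf_neq0.
have q1 : x1 * z1 = (t * a1)%:MP * (X1 * Y1).
  by rewrite /x1 /z1 /t invfM; ring.
have q2 : x2 * z2 = (t * a2)%:MP * (X2 * Y2).
  rewrite (_ : t * a2 = (f * b2 / f') * (b1 / (a1 * e)));
    first by rewrite /x2 /z2; ring.
  apply: (mulfI a10); rewrite mulrCA hab /t; field; by rewrite a10 e0 f'0.
have q3 : x3 * z3 = (t * a3)%:MP * (X3 * Y3).
  by rewrite /x3 /z3 /t invfM; ring.
have := riemann_identity ex ez; rewrite q1 q2 q3.
set U := x1 * z3 - _ - _; set W := x1 + x3 + z2 => eQ.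
have hx1 : x1 \is 1.-homog by rewrite /x1 mul_mpolyC rpredZ.
have hx3 : x3 \is 1.-homog by rewrite /x3 mul_mpolyC rpredZ.
have hz1 : z1 \is 1.-homog by rewrite /z1 mul_mpolyC rpredZ.
have hz2 : z2 \is 1.-homog by rewrite /z2 mul_mpolyC rpredZ.
have hz3 : z3 \is 1.-homog by rewrite /z3 mul_mpolyC rpredZ.
have hU : U \is 2.-homog.
  have hW : W \is 1.-homog by rewrite !rpredD.
  by rewrite /U; apply: rpredB; [apply: rpredB|]; apply: (@dhomogM _ _ _ 1 _ 1).
have ti : t^-1%:MP * t%:MP = 1 :> {mpoly L[3]} by rewrite -mpolyCM mulVf.
exists (t^-1%:MP * U), ((t^-1)%:MP ^+ 2 * 4%:R * ((f * a1 / f') * (f / e))%:MP * W).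
split; first by rewrite mul_mpolyC rpredZ.
have eQt : t%:MP ^+ 2 * Q = riemann_form ((t * a1)%:MP * (X1 * Y1)) ((t * a2)%:MP * (X2 * Y2))
   ((t * a3)%:MP * (X3 * Y3)) by rewrite hQ /riemann_form; ring.
have -> : Q = t^-1%:MP ^+ 2 * (t%:MP ^+ 2 * Q)
  by rewrite mulrA -exprMn ti expr1n mul1r.
by rewrite eQt eQ /x1 /z3; ring.
Qed.
End Lines.
End RiemannModel.

(** * Orders of contact along a bitangent *)
Section LocalOrders.
Variable L : closedFieldType.
Implicit Types (F G H X Y A B C D E : {mpoly L[3]}) (P T S R Z : 'rV[L]_3).

Lemma homogZ_at F d P c : F \is d.-homog -> F.@[(c *: P) 0] = c ^+ d * F.@[P 0].
Proof.
move=> /dhomogP hF; rewrite !mevalE mulr_sumr big_seq [in RHS]big_seq.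
apply: eq_bigr => m /hF hm; rewrite mulrCA; congr (_ * _).
under eq_bigr do rewrite mxE exprMn.
by rewrite big_split /= prodrXr -mdegE hm.
Qed.

Lemma span_line X P T Z : linear_form X -> X.@[P 0] = 0 -> X.@[T 0] = 0 ->
  X.@[Z 0] = 0 -> (forall a b : L, a *: P + b *: T = 0 -> a = 0 /\ b = 0) ->
  exists a b, Z = a *: P + b *: T.
Proof.
move=> [hX X0] zP zT zZ free.
pose M : 'M[L]_3 := \matrix_(i < 3) tnth [tuple P; T; Z] i.
have /det0P[w w0 hw] : \det M == 0.
  rewrite -det_tr; apply/det0P; exists (\row_j X@_(U_(j)%MM)).
    apply: contraNneq X0 => h; rewrite [X]linear_mpolyE // big1 // => i _.
    by move/matrixP/(_ 0 i): h; rewrite !mxE => ->; rewrite mpolyC0 mul0r.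
  have hh S : X.@[S 0] = 0 -> \sum_j X@_(U_(j)%MM) * S 0 j = 0
    by rewrite linear_eval.
  apply/matrixP => i j; rewrite ord1 !mxE.
  rewrite -[RHS](hh (tnth [tuple P; T; Z] j)).
    by apply: eq_bigr => k _; rewrite !mxE.
  by case: j => -[|[|[|//]]] hj; rewrite (tnth_nth 0).
have e : w 0 0 *: P + w 0 1 *: T + w 0 2%:R *: Z = 0.
  rewrite -[RHS]hw mulmx_sum_row !big_ord_recl big_ord0 addr0 addrA.
  by congr (_ + _ + _); rewrite rowK (tnth_nth 0) /=; congr (w _ _ *: _);
    apply: val_inj.
have w2 : w 0 2%:R != 0.
  apply: contraNneq w0 => z; move: e; rewrite z scale0r addr0 => /free[h0 h1].
  apply/eqP/matrixP => i j; rewrite ord1 mxE.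
  case: j => -[|[|[|//]]] hj.
  - by rewrite -h0; congr (w _ _); apply: val_inj.
  - by rewrite -h1; congr (w _ _); apply: val_inj.
  - by rewrite -z; congr (w _ _); apply: val_inj.
exists (- (w 0 0 / w 0 2%:R)), (- (w 0 1 / w 0 2%:R)).
apply: (scalerI w2); rewrite scalerDr !scalerA.
apply/eqP; rewrite -subr_eq0 -[X in _ == X]e; apply/eqP.
rewrite opprD -!scaleNr addrC; congr (_ + _); congr (_ *: _ + _ *: _); field;
  exact: w2.
Qed.

Variable Q : {mpoly L[3]}.
Hypothesis Q_smooth : nonsingular Q.

Lemma ord_ge_le P F m n : (m <= n)%N -> ord_ge Q P F n -> ord_ge Q P F m.
Proof.
move=> hmn [h [a [h0 hv]]]; exists h, a; split=> //.
exact: vanishes_to_order_le hv.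
Qed.

Lemma ord_ge1 P F : F.@[P 0] = 0 -> ord_ge Q P F 1.
Proof.
move=> hF; exists 1, 0; rewrite /eval_at meval1 oner_eq0; split=> //.
by apply: vanishes_to_order1; rewrite mul1r mul0r subr0.
Qed.

Lemma ord_ge0 P F : ord_ge Q P F 0.
Proof. by exists 1, 0; rewrite /eval_at meval1 oner_eq0; split. Qed.

Lemma ord_ge1_zero P F : on_curve Q P -> ord_ge Q P F 1 -> F.@[P 0] = 0.
Proof.
rewrite /on_curve /eval_at => -[_ hQ] [h [a [h0 hv]]].
have := hv 0%MM; rewrite mdeg0 => /(_ isT);
  rewrite coef0_taylor mevalB !mevalM hQ.
by rewrite mulr0 subr0 => /eqP; rewrite mulf_eq0 (negPf h0) => /eqP.
Qed.

Lemma dvdX_coef0 (p : {poly L}) : ('X %| p) = (p`_0 == 0).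
Proof. by rewrite -['X]subr0 -polyC0 dvdp_XsubCl /root horner_coef0. Qed.

Lemma coprime_dvdX (p q : {poly L}) m : p`_0 != 0 -> 'X^m %| p * q -> 'X^m %| q.
Proof.
move=> p0; rewrite Gauss_dvdpr // coprimep_expl // coprimep_sym -['X]subr0 -polyC0.
by rewrite coprimep_XsubC /root horner_coef0.
Qed.

Lemma restr_linear X S T : linear_form X -> X.@[S 0] = 0 ->
  restr S T X = X.@[T 0] *: 'X.
Proof.
move=> [hX _] zS; rewrite [in LHS](linear_mpolyE hX) rmorph_sum /= linear_eval //.
have hh : (\sum_i X@_(U_(i)%MM) * S 0 i)%:P = 0 :> {poly L}
  by rewrite -linear_eval // zS.
transitivity ((\sum_i X@_(U_(i)%MM) * S 0 i)%:P +
  (\sum_i X@_(U_(i)%MM) * T 0 i) *: 'X); last by rewrite hh add0r.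
rewrite rmorph_sum scaler_suml -big_split; apply: eq_bigr => i _ /=.
by rewrite rmorphM /= restrC restrX polyCM -!mul_polyC polyCM; ring.
Qed.

(** If hX - aQ has order m >= 2 at S, comparing linear terms shows that a(S) is
    not zero, since h(S) and the differential of X are not.  On the line X = 0
    only aQ remains, so Q itself vanishes there to order m. *)
Lemma tangent_restr X S T m : linear_form X -> Q.@[S 0] = 0 ->
  X.@[S 0] = 0 -> X.@[T 0] = 0 -> ord_ge Q S X m -> 'X^m %| restr S T Q.
Proof.
move=> lX zQ zS zT [h [a [h0 hv]]]; rewrite /eval_at in h0.
case: m hv => [|[|m]] hv; first by rewrite expr0 dvd1p.
  by rewrite expr1 dvdX_coef0 coef0_restr zQ.
have a0 : a.@[S 0] != 0.
  apply/negP => /eqP a0; have [T' hT'] := linear_neq0 lX.1 lX.2.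
  have := restr_vanishes T' (vanishes_to_order_le (isT : 2 <= m.+2)%N hv).
  rewrite rmorphB !rmorphM /= (restr_linear T' lX zS) hT' scale1r.
  have hX2 : 'X^2 %| restr S T' a * restr S T' Q.
    by rewrite expr2 dvdp_mul // dvdX_coef0 coef0_restr ?a0 ?zQ.
  rewrite dvdp_subl // expr2 dvdp_mul2r ?polyX_eq0 // dvdX_coef0 coef0_restr.
  by rewrite (negPf h0).
have := restr_vanishes T hv; rewrite rmorphB !rmorphM /= (restr_linear T lX zS) zT.
rewrite scale0r mulr0 sub0r dvdpNr; apply: coprime_dvdX.
by rewrite coef0_restr.
Qed.

(** F is stationary along X = 0 at S, so its differential there is proportional
    to X. *)
Lemma gradient_multiple X S F : linear_form X ->
  (forall T, X.@[T 0] = 0 -> 'X^2 %| restr S T F) ->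
  exists c, forall i, (F^`M(i)).@[S 0] = c * X@_(U_(i)%MM).
Proof.
move=> [hX X0] h.
pose D := \sum_i ((F^`M(i)).@[S 0])%:MP * 'X_i : {mpoly L[3]}.
have hD : D \is 1.-homog.
  apply: rpred_sum => i _; rewrite mul_mpolyC rpredZ // dhomogX.
  by rewrite -[X in X == _]/(mdeg U_(i)%MM) mdeg1.
have evD T : D.@[T 0] = (restr S T F)`_1.
  rewrite coef1_restr /D rmorph_sum; apply: eq_bigr => i _ /=.
  by rewrite mevalM mevalC mevalXU mulrC.
have [T /h /dvdpP[q hq]|c hc] := linear_span1 hX X0 hD.
  by rewrite evD hq coefMXn.
exists c => i; rewrite -mcoeffZ -hc /D [RHS]raddf_sum /= (bigD1 i) //= big1 =>
  [|j hj].
  by rewrite mul_mpolyC mcoeffZ mcoeffX eqxx mulr1 addr0.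
by rewrite mul_mpolyC mcoeffZ mcoeffX eq_mnm1 (negPf hj) mulr0.
Qed.

Lemma smooth_gradient S : on_curve Q S -> ~ (forall i, (Q^`M(i)).@[S 0] = 0).
Proof. by move=> hS h; have [i] := Q_smooth hS; rewrite /eval_at h eqxx. Qed.

Section Bitangent.
Variables (X : {mpoly L[3]}) (P R : 'rV[L]_3).
Hypothesis bX : bitangent_at Q X P R.

Lemma bitangent_linear : linear_form X.
Proof. by case: bX. Qed.

Lemma contact_on_line S : on_curve Q S -> (0 < mult_in P R S)%N -> X.@[S 0] = 0.
Proof.
move=> hS hm; have [_ _ _ _ /(_ S hS 1%N)[_ h]] := bX.
by apply: (ord_ge1_zero hS); apply: h; rewrite muln_gt0.
Qed.

Lemma line_contact S : on_curve Q S -> X.@[S 0] = 0 -> (0 < mult_in P R S)%N.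
Proof.
move=> hS hX; have [_ _ _ _ /(_ S hS 1%N)[h _]] := bX.
by have := h (ord_ge1 hX); rewrite muln_gt0.
Qed.

Lemma restr_contact S T : on_curve Q S -> X.@[S 0] = 0 -> X.@[T 0] = 0 ->
  'X^(2 * mult_in P R S) %| restr S T Q.
Proof.
move=> hS zS zT; have [_ _ _ _ /(_ S hS (2 * mult_in P R S)%N)[_ h]] := bX.
by apply: (tangent_restr bitangent_linear hS.2 zS zT); apply: h.
Qed.

Lemma bitangent_gradient S : on_curve Q S -> X.@[S 0] = 0 ->
  exists2 c, c != 0 & forall i, (Q^`M(i)).@[S 0] = c * X@_(U_(i)%MM).
Proof.
move=> hS zS; have [|c hc] := @gradient_multiple X S Q bitangent_linear.
  move=> T zT; apply: dvdp_trans (restr_contact hS zS zT).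
  by apply: dvdp_exp2l; rewrite -{1}[2%N]muln1 leq_mul2l line_contact.
exists c => //; apply/negP => /eqP c0; apply: (smooth_gradient hS) => i.
by rewrite hc c0 mul0r.
Qed.

(** If Q = XH, then X has infinite order at a contact point, unless H vanishes
    there and the point is singular. *)
Lemma bitangent_not_dvd : ~ mdvd X Q.
Proof.
have [hX X0 hP _ h] := bX; move=> [H hH].
have mP : (0 < mult_in P R P)%N by rewrite /mult_in /same_point submx_refl.
have zP := contact_on_line hP mP.
have [zH|nH] := eqVneq (H.@[P 0]) 0.
  apply: (smooth_not_double Q_smooth hP.1); rewrite hH.
  exact: double_atM.
have /h : on_curve Q P := hP.
move=> /(_ 5%N)[h5 _]; have : ord_ge Q P X 5.
  exists H, 1; split=> // k _.
  by rewrite mul1r hH mulrC subrr /comp_mpoly mmap0 mcoeff0.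
by move/h5; rewrite /mult_in; case: same_point; case: same_point.
Qed.

(** On the line X = 0 the quartic Q is the square of U, so U vanishes there to
    half the order of Q.  When both contact points of X coincide, the
    differentials of U and Q at this point are proportional, and subtracting a
    multiple of Q from U makes the order two. *)
Lemma contact_on_conic U V S : Q = U ^+ 2 - X * V -> on_curve Q S ->
  ord_ge Q S U (mult_in P R S).
Proof.
move=> hQ hS.
have zU : X.@[S 0] = 0 -> U.@[S 0] = 0.
  move=> zS; have := hS.2; rewrite /eval_at {1}hQ mevalB (mevalM _ X V) zS mul0r subr0.
  by rewrite rmorphXn /= => /eqP; rewrite expf_eq0 => /eqP.
have [m0|] := posnP (mult_in P R S); first by rewrite m0; apply: ord_ge0.
move=> m0; have zS := contact_on_line hS m0.
have : (mult_in P R S <= 2)%N by rewrite /mult_in; case: same_point;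
  case: same_point.
rewrite leq_eqVlt ltnS => /orP[/eqP m2|m1]; last first.
  by apply: (ord_ge_le m1); apply: ord_ge1; apply: zU.
have [c c0 hc] := bitangent_gradient hS zS.
have [|d hd] := @gradient_multiple X S U bitangent_linear.
  move=> T zT; have := restr_contact hS zS zT.
  rewrite m2 {1}hQ rmorphB rmorphXn rmorphM /= (restr_linear T bitangent_linear zS) zT.
  by rewrite scale0r mul0r subr0 -[(2 * 2)%N]/(2 * 2)%N exprM dvdp_pexp2r.
rewrite m2; exists 1, (d / c)%:MP; rewrite /eval_at meval1 oner_eq0; split=> //.
apply: vanishes_to_order2; split=> [|i].
  by have zQ := hS.2; rewrite /eval_at in zQ;
    rewrite mevalB !mevalM zQ zU // !mulr0 subrr.
rewrite mul1r mderivB mul_mpolyC mderivZ mevalB mevalZ hc hd; field; exact: c0.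
Qed.
End Bitangent.

(** A point of the curve on a bitangent is a contact point, and the tangent of
    the curve there is unique. *)
Lemma bitangents_meet A B P1 R1 P2 R2 S : bitangent_at Q A P1 R1 ->
  bitangent_at Q B P2 R2 -> ~ proportional A B -> S != 0 ->
  A.@[S 0] = 0 -> B.@[S 0] = 0 -> Q.@[S 0] != 0.
Proof.
move=> bA bB hAB S0 zA zB; apply/negP => /eqP zQ; have hS : on_curve Q S by [].
have [c c0 hc] := bitangent_gradient bA hS zA.
have [d d0 hd] := bitangent_gradient bB hS zB.
apply: hAB; exists (d / c); first by rewrite mulf_neq0 ?invr_eq0.
have [hA _] := bitangent_linear bA; have [hB _] := bitangent_linear bB.
rewrite [A]linear_mpolyE // [B]linear_mpolyE // scaler_sumr;
  apply: eq_bigr => i _.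
rewrite -mul_mpolyC mulrA -mpolyCM; congr (_%:MP * _); apply: (mulfI c0).
by rewrite -hc hd mulrA; congr (_ * _); field.
Qed.
End LocalOrders.

(** * Syzygetic tetrads and identities Q = G^2 - c ABXY *)
Section ContactConics.
Variable L : closedFieldType.
Implicit Types (F G H X Y A B C D E : {mpoly L[3]}) (P T S R Z : 'rV[L]_3).
Variable Q : {mpoly L[3]}.
Hypothesis Q_homog : Q \is 4.-homog.
Hypothesis Q_smooth : nonsingular Q.

Lemma same_point_scale (a : L) P : a != 0 -> same_point (a *: P) P.
Proof. by move=> a0; apply/eqmxP/eqmx_scale. Qed.

Lemma on_curve_scale (a : L) P : a != 0 -> on_curve Q P -> on_curve Q (a *: P).
Proof.
move=> a0 [P0 hP]; split; first by rewrite scaler_eq0 (negPf a0).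
by rewrite /eval_at (homogZ_at _ _ Q_homog) [X in _ * X]hP mulr0.
Qed.

Lemma root_shift_dvd (f : {poly L}) z m :
  'X^m %| f \Po ('X + z%:P) -> ('X - z%:P) ^+ m %| f.
Proof.
move=> /dvdpP[q hq]; apply/dvdpP; exists (q \Po ('X - z%:P)).
have -> : f = (f \Po ('X + z%:P)) \Po ('X - z%:P).
  rewrite -comp_polyA comp_polyD comp_polyX comp_polyC.
  by rewrite subrK comp_polyXr.
by rewrite hq comp_polyM comp_Xn_poly.
Qed.

(** Choose a point T of the line off the curve and k such that F = G^2 - kQ
    vanishes at T.  On the line, F is a binary quartic form which vanishes at T,
    and to order two at each of the contact points (order four if they
    coincide): it has five zeros, so it vanishes identically. *)
Lemma contact_restriction X P R G : bitangent_at Q X P R -> G \is 2.-homog ->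
  (forall S, on_curve Q S -> ord_ge Q S G (mult_in P R S)) ->
  exists k, mdvd X (G ^+ 2 - k%:MP * Q).
Proof.
move=> bX hG hord; have lX := bitangent_linear bX; have [hX X0] := lX.
have [T [zT nT]] := not_mdvd_value hX X0 (bitangent_not_dvd Q_smooth bX).
pose k := G.@[T 0] ^+ 2 / Q.@[T 0]; exists k.
set F := _ - _.
have hF : F \is 4.-homog.
  by rewrite /F mul_mpolyC rpredB ?rpredZ // expr2 (dhomogM hG hG).
have FT : F.@[T 0] = 0.
  by rewrite /F mevalB rmorphXn mevalM mevalC /= /k divfK // subrr.
have restrF S : on_curve Q S -> X.@[S 0] = 0 ->
  'X^(2 * mult_in P R S) %| restr S T F.
  move=> hS zS; have dQ := restr_contact bX hS zS zT.
  rewrite /F rmorphB rmorphXn rmorphM /= dvdp_sub //; last exact: dvdp_mull.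
  rewrite mulnC exprM dvdp_exp2r //.
  have [h [a [h0 /(restr_vanishes T)]]] := hord S hS.
  rewrite rmorphB !rmorphM /= dvdp_subl; last first.
    by apply/dvdp_mull/(dvdp_trans _ dQ)/dvdp_exp2l; rewrite leq_pmull.
  by apply: coprime_dvdX; rewrite coef0_restr.
have [_ _ hP hR _] := bX.
have zP : X.@[P 0] = 0.
  by apply: (contact_on_line bX hP); rewrite /mult_in /same_point submx_refl.
have zR : X.@[R 0] = 0.
  by apply: (contact_on_line bX hR);
    rewrite /mult_in /same_point submx_refl addn1.
have free (a b : L) : a *: P + b *: T = 0 -> a = 0 /\ b = 0.
  move=> e; have b0 : b = 0.
    apply/eqP/negPn/negP => b0; case/negP: nT; apply/eqP.
    have -> : T = - (a / b) *: P.
      apply: (scalerI b0); rewrite scalerA; apply/eqP;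
        rewrite -subr_eq0 -e addrC.
      by apply/eqP; congr (_ + _); rewrite -scaleNr; congr (_ *: _); field.
    by rewrite (homogZ_at _ _ Q_homog) [X in _ * X]hP.2 mulr0.
  split=> //; move: e; rewrite b0 scale0r addr0 => /eqP.
  by rewrite scaler_eq0 (negPf hP.1) orbF => /eqP.
pose f := restr P T F.
(* The zero at T lowers the degree of f. *)
have fsize : (size f <= 4)%N.
  have [hs hc] := restr_homog P T hF; rewrite leqNgt; apply/negP => hlt.
  have es : size f = 5%N by apply/eqP; rewrite eqn_leq hs.
  have : lead_coef f == 0 by rewrite lead_coefE es hc FT.
  by rewrite lead_coef_eq0 => /eqP f0; rewrite f0 size_poly0 in es.
have f0 : f = 0.
  have : exists2 q : {poly L}, q %| f & size q = 5%N.
    have hPP : same_point P P by rewrite /same_point submx_refl.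
    have fP := restrF P hP zP.
    case hPR : (same_point P R).
      by exists 'X^4; rewrite ?size_polyXn //; move: fP;
        rewrite /mult_in hPP hPR.
    have [a [b eR]] := span_line lX zP zT zR free.
    have a0 : a != 0.
      apply: contraTneq nT => a0; rewrite negbK; have [R0 zQ] := hR.
      move: zQ; rewrite /eval_at eR a0 scale0r add0r (homogZ_at _ _ Q_homog) =>
        /eqP.
      rewrite mulf_eq0 expf_eq0 /= => /orP[/eqP b0|//].
      by move: R0; rewrite eR a0 b0 !scale0r addr0 eqxx.
    (* R' is the vector of the second contact point of the form P + zT. *)
    pose z := b / a; pose R' := a^-1 *: R.
    have ai : a^-1 != 0 by rewrite invr_eq0.
    have eR' : R' = P + z *: T.
      by rewrite /R' eR scalerDr !scalerA mulVf // scale1r mulrC.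
    have z0 : z != 0.
      apply: contraFneq hPR => z0; have ->
        : P = R' by rewrite eR' z0 scale0r addr0.
      exact: same_point_scale.
    have fR : 'X^2 %| restr R' T F.
      apply: dvdp_trans (restrF R' (on_curve_scale ai hR) _); last first.
        by rewrite (linearZ_at _ _ hX) zR mulr0.
      apply: dvdp_exp2l; rewrite -{1}[2%N]muln1 leq_mul2l /= /mult_in.
      by rewrite same_point_scale // addn1.
    exists ('X^2 * ('X - z%:P) ^+ 2).
      rewrite Gauss_dvdp.
        apply/andP; split; first by move: fP; rewrite /mult_in hPP hPR.
        by apply: root_shift_dvd; rewrite -restr_shift -eR'.
      apply/coprimep_expl/coprimep_expr.
      by rewrite coprimep_XsubC /root hornerX.
    by rewrite size_mul ?expf_neq0 ?polyX_eq0 ?polyXsubC_eq0 // size_polyXn size_exp_XsubC.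
  move=> [q dq sq]; apply/eqP/negPn/negP => fN0.
  by have := leq_trans (dvdp_leq fN0 dq) fsize; rewrite sq.
apply: (mdvd_vanish hX X0) => Z zZ.
have [a [b ->]] := span_line lX zP zT zZ free.
have [a0|a0] := eqVneq a 0.
  by rewrite a0 scale0r add0r (homogZ_at _ _ hF) FT mulr0.
have -> : a *: P + b *: T = a *: (P + (b / a) *: T).
  by rewrite scalerDr scalerA mulrC divfK.
by rewrite (homogZ_at _ _ hF) -horner_restr -/f f0 horner0 mulr0.
Qed.

Lemma closed_sqrt (a : L) : exists b, b ^+ 2 = a.
Proof.
have /closed_rootP[b] : size ('X^2 - a%:P) != 1%N by rewrite size_XnsubC.
by rewrite rootE !hornerE subr_eq0 => /eqP; exists b.
Qed.

(** The conic through the contact points gives a constant k on each of the four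
    lines.  These constants agree because any two of the lines meet off the
    curve, and then all four lines divide G^2 - kQ. *)
Lemma syzygetic_identity A B X Y : syzygetic Q [tuple A; B; X; Y] ->
  exists G c, [/\ G \is 2.-homog,
    c != 0 & Q = G ^+ 2 - c%:MP * (A * B * (X * Y))].
Proof.
move=> [[_ dist] [P [R [bt [G [hG G0 hord]]]]]].
set t := [tuple A; B; X; Y] in dist bt.
have lt i : linear_form (tnth t i) by apply: bitangent_linear (bt i).
have hk i : exists k, mdvd (tnth t i) (G ^+ 2 - k%:MP * Q).
  apply: (contact_restriction (bt i) hG) => S hS.
  apply: ord_ge_le (hord S hS).
  by rewrite (bigD1 i) //= leq_addr.
have [k hk0] := hk 0.
have dk i : mdvd (tnth t i) (G ^+ 2 - k%:MP * Q).
  have [->//|i0] := eqVneq i 0; have [k' hk'] := hk i.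
  have [S S0 [z0 zi]] := lines_meet (lt 0).1 (lt i).1.
  have nQ := bitangents_meet Q_smooth (bt 0) (bt i) (dist 0 i _) S0 z0 zi.
  have := mdvd_at hk0 z0; have := mdvd_at hk' zi.
  rewrite !mevalB !(mevalM _ _%:MP) !mevalC => e1 e2.
  suff <- : k' = k by [].
  apply: (mulIf (nQ _)); first by rewrite eq_sym.
  by apply: oppr_inj; apply: (addrI (G ^+ 2).@[S 0]); rewrite e1 e2.
have lA := lt 0; have lB := lt 1; have lX := lt 2%:R; have lY := lt 3%:R.
have dA := dk 0; have dB := dk 1; have dX := dk 2%:R; have dY := dk 3%:R.
have nAB := dist 0 1 isT; have nAX := dist 0 2%:R isT;
  have nAY := dist 0 3%:R isT.
have nBX := dist 1 2%:R isT; have nBY := dist 1 3%:R isT;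
  have nXY := dist 2%:R 3%:R isT.
rewrite !(tnth_nth 0) /= in lA lB lX lY dA dB dX dY nAB nAX nAY nBX nBY nXY.
have hF : G ^+ 2 - k%:MP * Q \is 4.-homog.
  by rewrite mul_mpolyC rpredB ?rpredZ // expr2 (dhomogM hG hG).
have [F1 e1] := dA.
have [F2 e2] : mdvd B F1 by apply: (mdvdM lB.1 lB.2 lA.1 lA.2 nAB); rewrite -e1.
have [F3 e3] : mdvd X F2.
  apply: (mdvdM lX.1 lX.2 lB.1 lB.2 nBX);
    apply: (mdvdM lX.1 lX.2 lA.1 lA.2 nAX).
  by rewrite -e2 -e1.
have [F4 e4] : mdvd Y F3.
  apply: (mdvdM lY.1 lY.2 lX.1 lX.2 nXY);
    apply: (mdvdM lY.1 lY.2 lB.1 lB.2 nBY).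
  by apply: (mdvdM lY.1 lY.2 lA.1 lA.2 nAY); rewrite -e3 -e2 -e1.
have h4 : F4 \is 0.-homog.
  apply: (homog_quotient lY.1 lY.2); apply: (homog_quotient lX.1 lX.2).
  apply: (homog_quotient lB.1 lB.2); apply: (homog_quotient lA.1 lA.2).
  by rewrite -e4 -e3 -e2 -e1.
have := homog0_const h4; set c := _@__ => ec.
have eF : G ^+ 2 - k%:MP * Q = c%:MP * (A * B * (X * Y)).
  by rewrite e1 e2 e3 e4 ec; ring.
(* Otherwise three distinct lines divide the conic G. *)
have k0 : k != 0.
  apply/negP => /eqP z; case/negP: G0; apply/eqP.
  move: eF; rewrite z mpolyC0 mul0r subr0 => eG.
  have dd V : linear_form V -> mdvd V (G ^+ 2) -> mdvd V G.
    by move=> lV; rewrite expr2 => /(mdvd_prime lV.1 lV.2)[].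
  apply: (three_lines_quadric lA lB lX nAB nAX nBX hG); apply: dd => //;
    rewrite eG.
  - by exists (c%:MP * B * X * Y); ring.
  - by exists (c%:MP * A * X * Y); ring.
  - by exists (c%:MP * A * B * Y); ring.
have [s es] := closed_sqrt k^-1.
have eQ : Q = (s%:MP * G) ^+ 2 - (k^-1 * c)%:MP * (A * B * (X * Y)).
  apply: (mulfI (_ : k%:MP != 0)); first by rewrite mpolyC_eq0.
  have ek : k%:MP * (k^-1)%:MP = 1 :> {mpoly L[3]} by rewrite -mpolyCM divff.
  rewrite exprMn -rmorphXn es.
  transitivity (k%:MP * (k^-1)%:MP * (G ^+ 2 - c%:MP * (A * B * (X * Y))));
    last by ring.
  by rewrite ek mul1r -eF; ring.
exists (s%:MP * G), (k^-1 * c); split=> //; first by rewrite mul_mpolyC rpredZ.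
(* If c were zero, Q would be a square, singular at every point. *)
rewrite mulf_neq0 ?invr_eq0 //; apply/negP => /eqP c0.
have [_ _ hP _ _] := bt 0.
move: eQ; rewrite c0 mulr0 mpolyC0 mul0r subr0 => eQ.
apply: (smooth_not_double Q_smooth hP.1); have := hP.2.
rewrite /eval_at eQ rmorphXn /= => /eqP; rewrite expf_eq0 => /eqP z.
by rewrite expr2; apply: double_atM.
Qed.

(** Each point of the curve lies on at most one of the three lines, so the
    condition on U is the one of [contact_on_conic] for a single line. *)
Lemma contacts_on_conic3 U W (t : 3.-tuple {mpoly L[3]}) :
  distinct_bitangents Q t -> U \is 2.-homog ->
  Q = U ^+ 2 - tnth t 0 * tnth t 1 * tnth t 2%:R * W -> contacts_on_conic Q t.
Proof.
move=> [bt dist] hU hQ.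
have [P0 [R0 b0]] := bt 0; have [P1 [R1 b1]] := bt 1;
  have [P2 [R2 b2]] := bt 2%:R.
pose P (i : 'I_3) := tnth [tuple P0; P1; P2] i.
pose R (i : 'I_3) := tnth [tuple R0; R1; R2] i.
have b i : bitangent_at Q (tnth t i) (P i) (R i).
  case: i => -[|[|[|//]]] hi.
  - by move: b0; rewrite /P /R !(tnth_nth 0).
  - by move: b1; rewrite /P /R !(tnth_nth 0).
  - by move: b2; rewrite /P /R !(tnth_nth 0).
have factor i : exists V, Q = U ^+ 2 - tnth t i * V.
  case: i => -[|[|[|//]]] hi.
  - exists (tnth t 1 * tnth t 2%:R * W); rewrite {1}hQ.
    by rewrite (_ : Ordinal hi = 0); [ring|apply: val_inj].
  - exists (tnth t 0 * tnth t 2%:R * W); rewrite {1}hQ.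
    by rewrite (_ : Ordinal hi = 1); [ring|apply: val_inj].
  - exists (tnth t 0 * tnth t 1 * W); rewrite {1}hQ.
    by rewrite (_ : Ordinal hi = 2%:R); [ring|apply: val_inj].
have lt i := bitangent_linear (b i).
have zU S i : Q.@[S 0] = 0 -> (tnth t i).@[S 0] = 0 -> U.@[S 0] = 0.
  have [V hV] := factor i; move=> + zi;
    rewrite hV mevalB (mevalM _ _ V) zi mul0r subr0.
  by rewrite rmorphXn /= => /eqP; rewrite expf_eq0 => /eqP.
have disj S i j : i != j -> on_curve Q S -> (tnth t i).@[S 0] = 0 ->
    (tnth t j).@[S 0] = 0 -> False.
  move=> hij hS zi zj; have := bitangents_meet Q_smooth (b i) (b j) (dist i j hij) hS.1 zi zj.
  by rewrite [X in X != _]hS.2 eqxx.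
exists P, R; split=> //; exists U; split=> // [|S hS].
  apply/negP => /eqP U0; have [S S0 [z0 z1]] := lines_meet (lt 0).1 (lt 1).1.
  apply: (smooth_form_at Q_smooth (G := 0) (c := 1) (E := tnth t 0)
    (F := tnth t 1 * tnth t 2%:R * W) _ S0) => //.
  - by rewrite {1}hQ U0 mpolyC1; ring.
  - by rewrite meval0.
  - by rewrite !mevalM z1 !mul0r.
case: (pickP (fun i => (0 < mult_in (P i) (R i) S)%N)) => [i hi|h]; last first.
  rewrite big1 => [|i _]; first exact: ord_ge0.
  by apply/eqP; move/negbT: (h i); rewrite -eqn0Ngt.
have zi := contact_on_line (b i) hS hi.
rewrite (bigD1 i) //= big1 => [|j hj].
  by have [V hV] := factor i; rewrite addn0;
    apply: (contact_on_conic Q_smooth (b i) hV).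
have [//|mj] := posnP (mult_in (P j) (R j) S).
by case: (disj S j i hj hS (contact_on_line (b j) hS mj) zi).
Qed.
End ContactConics.

(** * Steiner complexes *)
Section SteinerComplex.
Variable L : closedFieldType.
Implicit Types (F G H X Y Z W A B C D E : {mpoly L[3]}).
Hypothesis two_neq0 : 2%:R != 0 :> L.
Variable Q : {mpoly L[3]}.
Hypothesis Q_homog : Q \is 4.-homog.
Hypothesis Q_smooth : nonsingular Q.

Lemma same_pair_mul X Y Z W : same_pair X Y Z W -> proportional (X * Y) (Z * W).
Proof.
case=> -[[c c0 ->] [d d0 ->]]; exists (c * d); rewrite ?mulf_neq0 //;
by rewrite -!mul_mpolyC; ring.
Qed.

Lemma proportional_linear X Y : proportional X Y -> linear_form Y ->
  linear_form X.
Proof.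
by move=> [c c0 ->] [hY Y0]; split; rewrite ?rpredZ // scaler_eq0 negb_or c0.
Qed.

Lemma distinct_linear n (t : n.-tuple {mpoly L[3]}) i :
  distinct_bitangents Q t -> linear_form (tnth t i).
Proof. by move=> [bt _]; have [P [R /bitangent_linear]] := bt i. Qed.

Lemma distinct_pair A B : distinct_bitangents Q [tuple A; B] ->
  [/\ linear_form A, linear_form B & ~ proportional A B].
Proof.
move=> h; have lA := distinct_linear 0 h; have lB := distinct_linear 1 h.
by have := h.2 0 1 isT; rewrite !(tnth_nth 0) /= in lA lB *.
Qed.

Lemma distinct_tetrad A B Z W : distinct_bitangents Q [tuple A; B; Z; W] ->
  [/\ linear_form Z, linear_form W & ~ proportional Z W].
Proof.
move=> h; have lA := distinct_linear 2%:R h; have lB := distinct_linear 3%:R h.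
by have := h.2 2%:R 3%:R isT; rewrite !(tnth_nth 0) /= in lA lB *.
Qed.

Section Complex.
Variables A B : {mpoly L[3]}.
Hypothesis hAB : distinct_bitangents Q [tuple A; B].

Lemma steiner_linear Z W : in_steiner_complex Q A B Z W ->
  [/\ linear_form Z, linear_form W & ~ proportional Z W].
Proof.
have [lA lB nAB] := distinct_pair hAB.
case=> [[[pZ pW]|[pZ pW]]|[h _]]; last exact: distinct_tetrad h.
  split; [exact: proportional_linear lA|exact: proportional_linear lB|move=> h].
  apply: nAB; apply: proportional_trans pW; apply: proportional_trans h.
  exact: proportional_sym.
split; [exact: proportional_linear lB|exact: proportional_linear lA|move=> h].
apply: nAB; apply: proportional_sym; apply: proportional_trans pW.
by apply: proportional_trans h; apply: proportional_sym.
Qed.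

(** For products of two lines each this expresses that the four lines form a
    syzygetic tetrad. *)
Definition syzygetic_products E1 E2 := exists G c,
  [/\ G \is 2.-homog, c != 0 & Q = G ^+ 2 - c%:MP * (E1 * E2)].

Lemma syzygetic_products_prop E1 E1' E2 : proportional E1 E1' ->
  syzygetic_products E1' E2 -> syzygetic_products E1 E2.
Proof.
move=> [d d0 ->] [G [c [hG c0 hQ]]]; exists G, (c / d); split=> //.
  by rewrite mulf_neq0 ?invr_eq0.
rewrite -mul_mpolyC {1}hQ; congr (_ - _).
rewrite (_ : c%:MP = (c / d)%:MP * d%:MP :> {mpoly L[3]}); first by ring.
by rewrite -mpolyCM divfK.
Qed.

Lemma syzygetic_productsC E1 E2 : syzygetic_products E1 E2 ->
  syzygetic_products E2 E1.
Proof. by move=> [G [c [hG c0 hQ]]]; exists G, c; rewrite [E2 * _]mulrC. Qed.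

(** Any two pairs of a Steiner complex form a syzygetic tetrad: for pairs other
    than (A, B) itself, use the symmetry of the Riemann form of the three pairs
    (A, B), (X1, Y1), (X2, Y2). *)
Lemma steiner_products X1 Y1 X2 Y2 : in_steiner_complex Q A B X1 Y1 ->
  in_steiner_complex Q A B X2 Y2 -> ~ same_pair X1 Y1 X2 Y2 ->
  syzygetic_products (X1 * Y1) (X2 * Y2).
Proof.
move=> h1 h2 h12; have [l1 k1 _] := steiner_linear h1.
have [l2 k2 _] := steiner_linear h2; have [lA lB nAB] := distinct_pair hAB.
have nE : ~ proportional (X1 * Y1) (X2 * Y2).
  by move=> h; apply: h12; apply: proportional_mul_same_pair h.
case: h1 => [/same_pair_mul p1|/(syzygetic_identity Q_homog Q_smooth) [G1 [c1 [hG1 c10 hQ1]]]].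
  case: h2 => [/same_pair_mul p2|/(syzygetic_identity Q_homog Q_smooth) s2].
    by case: nE; apply: proportional_trans p1 _; apply: proportional_sym.
  exact: syzygetic_products_prop p1 s2.
case: h2 => [/same_pair_mul p2|/(syzygetic_identity Q_homog Q_smooth) [G2 [c2 [hG2 c20 hQ2]]]].
  apply: syzygetic_productsC; apply: syzygetic_products_prop p2 _.
  by exists G1, c1.
have [a [b [c [a0 b0 c0 hQ]]]] :=
  three_pairs two_neq0 Q_smooth lA lB nAB hG1 hG2 c10 c20 hQ1 hQ2 nE.
exists (b%:MP * (X1 * Y1) + c%:MP * (X2 * Y2) - a%:MP * (A * B)),
  (4%:R * b * c).
have hM Z W d : linear_form Z -> linear_form W -> d%:MP * (Z * W) \is 2.-homog.
  by move=> [hZ _] [hW _]; rewrite mul_mpolyC; apply/rpredZ/(dhomogM hZ hW).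
split; first by rewrite rpredB ?rpredD ?hM.
  by rewrite !mulf_neq0 // -[4%N]/(2 * 2)%N natrM mulf_neq0.
by rewrite {1}hQ /riemann_form; ring.
Qed.

Lemma steiner_riemann_form X1 Y1 X2 Y2 X3 Y3 :
  in_steiner_complex Q A B X1 Y1 -> in_steiner_complex Q A B X2 Y2 ->
  in_steiner_complex Q A B X3 Y3 -> ~ same_pair X1 Y1 X2 Y2 ->
  ~ same_pair X1 Y1 X3 Y3 -> ~ same_pair X2 Y2 X3 Y3 ->
  exists a b c, [/\ a != 0, b != 0, c != 0 & Q = riemann_form
    (a%:MP * (X1 * Y1)) (b%:MP * (X2 * Y2)) (c%:MP * (X3 * Y3))].
Proof.
move=> h1 h2 h3 h12 h13 h23; have [l1 k1 n1] := steiner_linear h1.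
have [l2 k2 _] := steiner_linear h2; have [l3 k3 _] := steiner_linear h3.
have [G1 [c1 [hG1 c10 hQ1]]] := steiner_products h1 h2 h12.
have [G2 [c2 [hG2 c20 hQ2]]] := steiner_products h1 h3 h13.
apply: (three_pairs two_neq0 Q_smooth l1 k1 n1 hG1 hG2 c10 c20 hQ1 hQ2) => h.
by apply: h23; apply: proportional_mul_same_pair h.
Qed.
End Complex.

(** Three lines on which the terms vanish and which had a common point would
    make this point singular. *)
Lemma riemann_bracket_neq0 E0 E1 E2 A B C : Q = riemann_form E0 E1 E2 ->
  linear_form A -> linear_form B -> linear_form C ->
  (forall P : 'rV[L]_3, A.@[P 0] = 0 -> B.@[P 0] = 0 -> C.@[P 0] = 0 ->
     [/\ E0.@[P 0] = 0, E1.@[P 0] = 0 & E2.@[P 0] = 0]) ->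
  bracket A B C != 0.
Proof.
move=> hQ [hA _] [hB _] [hC _] h; apply/negP => /eqP /(bracket0_zero hA hB hC).
move=> [P P0 [zA zB zC]]; have [z0 z1 z2] := h P zA zB zC.
exact: (riemann_form_smooth Q_smooth hQ P0).
Qed.

(** The formula over an algebraically closed field.  The bracket quotients are
    r_i s_i by Cramer's rule applied to the two expressions of X7. *)
Lemma steiner_formula A B X1 Y1 X2 Y2 X3 Y3 X7 Y7 :
  distinct_bitangents Q [tuple A; B] ->
  in_steiner_complex Q A B X1 Y1 -> in_steiner_complex Q A B X2 Y2 ->
  in_steiner_complex Q A B X3 Y3 -> ~ same_pair X1 Y1 X2 Y2 ->
  ~ same_pair X1 Y1 X3 Y3 -> ~ same_pair X2 Y2 X3 Y3 ->
  in_steiner_complex Q X1 Y2 X7 Y7 -> ~ same_pair X7 Y7 X1 Y2 ->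
  ~ same_pair X7 Y7 X2 Y1 -> asyzygetic Q [tuple X1; X3; X7] ->
  let d := bracket X1 X2 X3 * bracket Y1 Y2 Y3 in
  let a1 := bracket X7 X2 X3 * bracket X7 Y2 Y3 / d in
  let a2 := bracket X1 X7 X3 * bracket Y1 X7 Y3 / d in
  let a3 := bracket X1 X2 X7 * bracket Y1 Y2 X7 / d in
  proportional Q
    ((a1 *: (X1 * Y1) + a2 *: (X2 * Y2) - a3 *: (X3 * Y3)) ^+ 2
     - (4%:R * a1 * a2) *: (X1 * Y1 * X2 * Y2)).
Proof.
move=> hAB h1 h2 h3 h12 h13 h23 h7 h712 h721 [dX7 nX7].
have [l1 k1 n1] := steiner_linear hAB h1;
  have [l2 k2 _] := steiner_linear hAB h2.
have [l3 k3 _] := steiner_linear hAB h3.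
have s7 : syzygetic Q [tuple X1; Y2; X7; Y7] by case: h7.
have [l7 k7 _] := distinct_tetrad s7.1.
have [a [b [c [a0 b0 c0 hQ]]]] := steiner_riemann_form hAB h1 h2 h3 h12 h13 h23.
have hb := riemann_bracket_neq0 hQ.
have van X Y d (P : 'rV[L]_3) : X.@[P 0] = 0 \/ Y.@[P 0] = 0 ->
  (d%:MP * (X * Y)).@[P 0] = 0.
  by rewrite !mevalM; case=> ->; rewrite ?mul0r !mulr0.
have bX : bracket X1 X2 X3 != 0 by apply: hb => // P ? ? ?; split; apply: van;
  auto.
have bY : bracket Y1 Y2 Y3 != 0 by apply: hb => // P ? ? ?; split; apply: van;
  auto.
have bX' : bracket X1 X2 Y3 != 0 by apply: hb => // P ? ? ?; split; apply: van;
  auto.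
have bY' : bracket Y1 Y2 X3 != 0 by apply: hb => // P ? ? ?; split; apply: van;
  auto.
have nb U V W : linear_form U -> linear_form V -> linear_form W ->
    bracket U V W != 0 -> ~ proportional U V.
  move=> lU lV lW bN [e e0 eU]; have [P P0 [zV zW]] := lines_meet lV.1 lW.1.
  case/eqP: bN; apply: (bracket_common_zero (P := P)) => //;
    [exact: lU.1|exact: lV.1|exact: lW.1|].
  by rewrite eU mevalZ zV mulr0.
have b12 : bracket X1 Y2 Y3 != 0 by apply: hb => // P ? ? ?; split; apply: van;
  auto.
have b21 : bracket X2 Y1 Y3 != 0 by apply: hb => // P ? ? ?; split; apply: van;
  auto.
have n12 := nb _ _ _ l1 k2 k3 b12.
have [G1 [c1 [hG1 c10 hQ1]]] := steiner_products hAB h1 h2 h12.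
have [G2 [c2 [hG2 c20 hQ2]]] := syzygetic_identity Q_homog Q_smooth s7.
have hQ1' : Q = G1 ^+ 2 - c1%:MP * (X1 * Y2 * (X2 * Y1)) by rewrite {1}hQ1;
  ring.
have nE : ~ proportional (X2 * Y1) (X7 * Y7).
  move=> h; apply: h721; apply: proportional_mul_same_pair => //.
  exact: proportional_sym.
have [b1 [b2 [b3 [b10 b20 b30 hQ7]]]] :=
  three_pairs two_neq0 Q_smooth l1 k2 n12 hG1 hG2 c10 c20 hQ1' hQ2 nE.
have hb7 := riemann_bracket_neq0 hQ7.
have b7 : bracket X1 X2 X7 != 0 by apply: hb7 => // P ? ? ?; split; apply: van;
  auto.
have b7' : bracket Y1 Y2 X7 != 0 by apply: hb7 => // P ? ? ?; split; apply: van;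
  auto.
have [e [e1 eab euv]] := opposite_pairs two_neq0 Q_smooth l1 k1 l2 k2 n1
  (nb _ _ _ l1 l2 l3 bX) (nb _ _ _ l2 k1 k3 b21) (dhomogM l3.1 k3.1) (dhomogM l7.1 k7.1) hQ hQ7.
have eab' : a * b = (e * b1) * (e * b2) by rewrite eab mulrACA -expr2 e1 mul1r.
have euv' : a%:MP * (X1 * Y1) + b%:MP * (X2 * Y2) - c%:MP * (X3 * Y3) =
  (e * b1)%:MP * (X1 * Y2) + (e * b2)%:MP * (X2 * Y1) - (e * b3)%:MP * (X7 * Y7).
  by rewrite euv; ring.
have n37 : ~ proportional X3 X7 by have := dX7.2 1 2%:R isT;
  rewrite !(tnth_nth 0).
have [] := seventh_line l1 k1 l2 k2 l3 k3 l7 a0 c0 hQ eab' euv' n37 bX bY bX' bY' b7 b7'; last first.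
  move=> [U [W [hU hQU]]]; case: nX7.
  by apply: (contacts_on_conic3 Q_smooth dX7 hU (W := W));
    rewrite !(tnth_nth 0).
move=> [r1 [r2 [r3 [s1 [s2 [s3 [t [t0 er es [e11 e22 e33]]]]]]]]] d a1 a2 a3.
have d0 : d != 0 by rewrite /d mulf_neq0.
have A1 : a1 = t * a.
  by rewrite /a1 {1}er bracket_row1 es bracket_row1 mulrACA e11 /d mulfK.
have A2 : a2 = t * b.
  by rewrite /a2 {1}er bracket_row2 es bracket_row2 mulrACA e22 /d mulfK.
have A3 : a3 = t * c.
  by rewrite /a3 {1}er bracket_row3 es bracket_row3 mulrACA e33 /d mulfK.
exists (t ^- 2); first by rewrite invr_eq0 expf_neq0.
have t20 : t ^+ 2 != 0 by rewrite expf_neq0.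
apply: (scalerI t20); rewrite scalerA mulfV // scale1r A1 A2 A3 {1}hQ /riemann_form.
by rewrite -!mul_mpolyC; ring.
Qed.
End SteinerComplex.

Theorem theorem4p1
  (K : fieldType) (hK : 2%N \notin [pchar K])
  (* L is an algebraic closure of K *)
  (L : closedFieldType) (iota : {rmorphism K -> L})
  (hL : forall x : L, algebraicOver iota x)
  (Q : {mpoly K[3]}) (hQ : Q \is 4.-homog)
  (QL : {mpoly L[3]}) (hQL : QL = map_mpoly iota Q)
  (hns : nonsingular QL)
  (* a Steiner complex, given by one of its pairs *)
  (A B : {mpoly L[3]}) (hAB : distinct_bitangents QL [tuple A; B])
  (X1 Y1 X2 Y2 X3 Y3 : {mpoly L[3]})
  (h1 : in_steiner_complex QL A B X1 Y1)
  (h2 : in_steiner_complex QL A B X2 Y2)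
  (h3 : in_steiner_complex QL A B X3 Y3)
  (h12 : ~ same_pair X1 Y1 X2 Y2)
  (h13 : ~ same_pair X1 Y1 X3 Y3)
  (h23 : ~ same_pair X2 Y2 X3 Y3)
  (X7 Y7 : {mpoly L[3]})
  (h7 : in_steiner_complex QL X1 Y2 X7 Y7)
  (h712 : ~ same_pair X7 Y7 X1 Y2)
  (h721 : ~ same_pair X7 Y7 X2 Y1)
  (hX7 : asyzygetic QL [tuple X1; X3; X7])
  (hY7 : asyzygetic QL [tuple X1; Y3; Y7]) :
  let d := bracket X1 X2 X3 * bracket Y1 Y2 Y3 in
  let a1 := bracket X7 X2 X3 * bracket X7 Y2 Y3 / d in
  let a2 := bracket X1 X7 X3 * bracket Y1 X7 Y3 / d in
  let a3 := bracket X1 X2 X7 * bracket Y1 Y2 X7 / d in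
  proportional QL
    ((a1 *: (X1 * Y1) + a2 *: (X2 * Y2) - a3 *: (X3 * Y3)) ^+ 2
     - (4%:R * a1 * a2) *: (X1 * Y1 * X2 * Y2)).
Proof.
have two0 : 2%:R != 0 :> L.
  by rewrite -(rmorph_nat iota) fmorph_eq0; move: hK; rewrite inE.
have QL_homog : QL \is 4.-homog.
  apply/dhomogP => m; rewrite hQL mcoeff_msupp mcoeff_map_mpoly fmorph_eq0 -mcoeff_msupp.
  exact: dhomog_mf hQ m.
exact: (steiner_formula two0 QL_homog hns hAB h1 h2 h3 h12 h13 h23 h7 h712 h721 hX7).
Qed.
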